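(* Let $\mathbf{L}\in Q(\mathbb{B}^n)$. An analytic function $F:\mathbb{B}^n\to\mathbb{C}$ has bounded $\mathbf{L}$-index in joint variables if and only if for each $R\in\mathbb{R}^n_+$ with $|R|\le\beta$ there exist $n_0\in\mathbb{Z}_+$ and $p_0>0$ such that for every $z^0\in\mathbb{B}^n$ there exists $K^0\in\mathbb{Z}^n_+$ with $\|K^0\|\le n_0$ and $$\max\left\{\frac{|F^{(K)}(z)|}{K!\,\mathbf{L}^K(z)}:\ \|K\|\le n_0,\ z\in\mathbb{D}^n\left[z^0,R/\mathbf{L}(z^0)\right]\right\}\le p_0\,\frac{|F^{(K^0)}(z^0)|}{K^0!\,\mathbf{L}^{K^0}(z^0)}.$$
   Context: $\mathbb{R}_+=[0,\infty)$, $\mathbb{Z}_+=\{0,1,2,\dots\}$. $|\cdot|$ is the Euclidean norm on $\mathbb{C}^n$ (and on $\mathbb{R}^n$); $\mathbb{B}^n=\{z\in\mathbb{C}^n:|z|<1\}$. For $K\in\mathbb{Z}^n_+$: $\|K\|=k_1+\dots+k_n$, $K!=k_1!\cdots k_n!$, $A^K=a_1^{k_1}\cdots a_n^{k_n}$, and $F^{(K)}=\partial^{\|K\|}F/\partial z_1^{k_1}\cdots\partial z_n^{k_n}$. Quotients $A/B$ of vectors are componentwise. $\mathbb{D}^n[z^0,R]=\{z:|z_j-z^0_j|\le r_j,\ j=1,\dots,n\}$ for $R=(r_1,\dots,r_n)\in\mathbb{R}^n_+$. Fix a constant $\beta>\sqrt n$. Throughout, $\mathbf{L}(z)=(l_1(z),\dots,l_n(z))$,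 where each $l_j:\mathbb{B}^n\to\mathbb{R}_+$ is continuous and $l_j(z)>\beta/(1-|z|)$ for all $z\in\mathbb{B}^n$. (Then $\mathbb{D}^n[z^0,R/\mathbf{L}(z^0)]\subset\mathbb{B}^n$ whenever $z^0\in\mathbb{B}^n$, $|R|\le\beta$.) $Q(\mathbb{B}^n)$ is the class of such $\mathbf{L}$ satisfying, for all $R\in\mathbb{R}^n_+$ with $|R|\le\beta$ and all $j$, $0<\lambda_{1,j}(R)\le\lambda_{2,j}(R)<\infty$, where $\lambda_{1,j}(R)$ and $\lambda_{2,j}(R)$ are respectively the infimum and the supremum of $l_j(z)/l_j(z^0)$ over all $z^0\in\mathbb{B}^n$ and $z\in\mathbb{D}^n[z^0,R/\mathbf{L}(z^0)]$. An analytic $F:\mathbb{B}^n\to\mathbb{C}$ is of bounded $\mathbf{L}$-index in joint variables if there is $m\in\mathbb{Z}_+$ such that for all $z\in\mathbb{B}^n$ and $J\in\mathbb{Z}^n_+$: $\frac{|F^{(J)}(z)|}{J!\mathbf{L}^J(z)}\le\max\{\frac{|F^{(K)}(z)|}{K!\mathbf{L}^K(z)}:K\in\mathbb{Z}^n_+,\|K\|\le m\}$. *)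

(* Defs.v *)
From HB Require Import structures.
From mathcomp Require Import all_boot all_order all_algebra.
From mathcomp Require Import complex.
From mathcomp Require Import all_classical all_reals all_analysis.

Set Implicit Arguments.
Unset Strict Implicit.
Unset Printing Implicit Defensive.

Import Order.TTheory GRing.Theory Num.Theory.
Import numFieldNormedType.Exports.

Local Open Scope classical_set_scope.
Local Open Scope ring_scope.

(* The complex field is R[i], for R : realType.  Functions on
   the unit ball are represented by total functions on 'rV[R[i]]_n; their
   values outside the ball never matter, the ball being open. *)

(* R[i] as a normed module over itself; on 'rV[R[i]]_n this gives the product
   topology. *)
HB.instance Definition _ (R : rcfType) := NormedModule.copy R[i] (R[i])^o.

Section MultiIndices.
Variable n : nat.

Definition multiindex := {ffun 'I_n -> nat}.

Definition mi_norm (K : multiindex) : nat := (\sum_(j < n) K j)%N.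

Definition mi_fact (K : multiindex) : nat := (\prod_(j < n) (K j)`!)%N.

Definition mi_pow (S : comNzRingType) (A : 'rV[S]_n) (K : multiindex) : S :=
  \prod_(j < n) A ord0 j ^+ K j.

(* {ffun 'I_n -> 'I_m.+1} is a finite type through which every multi-index of
   norm at most m can be reached. *)
Definition mi_of m (K : {ffun 'I_n -> 'I_m.+1}) : multiindex :=
  [ffun j => nat_of_ord (K j)].

End MultiIndices.

Section Norms.
Variables (R : realType) (n : nat).

Definition enorm (v : 'rV[R]_n) : R := Num.sqrt (\sum_(j < n) v ord0 j ^+ 2).

(* MathComp's `|z| on R[i] is itself an element of R[i], and on row vectors it
   is the maximum norm; Normc.normc is the real-valued modulus. *)
Definition cnorm (z : 'rV[R[i]]_n) : R := enorm (map_mx (@Normc.normc R) z).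

Definition uball : set 'rV[R[i]]_n := [set z | cnorm z < 1].

Definition polydisc (z0 : 'rV[R[i]]_n) (r : 'rV[R]_n) : set 'rV[R[i]]_n :=
  [set z | forall j : 'I_n, Normc.normc (z ord0 j - z0 ord0 j) <= r ord0 j].

Definition vdiv (A B : 'rV[R]_n) : 'rV[R]_n :=
  \row_j (A ord0 j / B ord0 j).

End Norms.

Section Analytic.
Variables (R : realType) (n : nat).
Implicit Type F : 'rV[R[i]]_n -> R[i].

(* Local expansion into an absolutely convergent power series
   sum_K c_K (z - a)^K. *)
Definition analytic_on_uball F : Prop :=
  forall a, uball a ->
  exists (c : multiindex n -> R[i]) (r : R), 0 < r /\
  forall z : 'rV[R[i]]_n,
    (forall j : 'I_n, Normc.normc (z ord0 j - a ord0 j) < r) ->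
    (\esum_(K in [set: multiindex n])
       (Normc.normc (c K * mi_pow (z - a) K))%:E < +oo)%E /\
    (fun N => \sum_(K : {ffun 'I_n -> 'I_N.+1} | (mi_norm (mi_of K) <= N)%N)
       c (mi_of K) * mi_pow (z - a) (mi_of K)) @ \oo --> F z.

(* The scalars of the normed modules at hand are R[i], so 'D is the limit of
   difference quotients with complex increments. *)
Definition pderiv (j : 'I_n) F : 'rV[R[i]]_n -> R[i] :=
  fun z => 'D_(delta_mx ord0 j : 'rV[R[i]]_n) F z.

Definition mderiv (K : multiindex n) F : 'rV[R[i]]_n -> R[i] :=
  foldr (fun j G => iter (K j) (pderiv j) G) F (enum 'I_n).

End Analytic.

Section BoundedIndex.
Variables (R : realType) (n : nat).
Implicit Types (F : 'rV[R[i]]_n -> R[i]) (L : 'rV[R[i]]_n -> 'rV[R]_n).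

Definition ratio_set L (rad : 'rV[R]_n) (j : 'I_n) : set (\bar R) :=
  [set x | exists z0 z, [/\ uball z0, polydisc z0 (vdiv rad (L z0)) z
                          & x = (L z ord0 j / L z0 ord0 j)%:E]].

Definition lambda1 L rad j : \bar R := ereal_inf (ratio_set L rad j).

Definition lambda2 L rad j : \bar R := ereal_sup (ratio_set L rad j).

Definition classQ (beta : R) L : Prop :=
  [/\ forall j : 'I_n, {within @uball R n, continuous (fun z => L z ord0 j)},
      forall (z : 'rV[R[i]]_n) (j : 'I_n), uball z ->
        0 <= L z ord0 j /\ beta / (1 - cnorm z) < L z ord0 j
    & forall rad : 'rV[R]_n, (forall j : 'I_n, 0 <= rad ord0 j) ->
        enorm rad <= beta ->
        forall j : 'I_n,
          [/\ (0 < lambda1 L rad j)%E, (lambda1 L rad j <= lambda2 L rad j)%E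
            & (lambda2 L rad j < +oo)%E]].

Definition normalized_deriv F L (z : 'rV[R[i]]_n) (K : multiindex n) : R :=
  Normc.normc (mderiv K F z) / ((mi_fact K)%:R * mi_pow (L z) K).

(* The default value 0 of the maximum is harmless: the terms are nonnegative
   and the zero multi-index is always in the range. *)
Definition bounded_index F L : Prop :=
  exists m : nat, forall (z : 'rV[R[i]]_n) (J : multiindex n), uball z ->
    normalized_deriv F L z J <=
    \big[Num.max/0]_(K : {ffun 'I_n -> 'I_m.+1} | (mi_norm (mi_of K) <= m)%N)
      normalized_deriv F L z (mi_of K).

End BoundedIndex.

Definition is_maximum (R : realType) (A : set R) (M : R) : Prop :=
  A M /\ ubound A M.

(* Main.v *)
Require Import Defs.
From mathcomp Require Import all_boot all_order all_algebra.
From mathcomp Require Import complex.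
From mathcomp Require Import all_classical all_reals all_analysis.
From mathcomp Require Import cyclic separable.
From mathcomp Require cyclotomic.
From mathcomp Require Import ring lra.
Import Order.TTheory GRing.Theory Num.Theory.
Import numFieldNormedType.Exports.
Local Open Scope classical_set_scope.
Local Open Scope ring_scope.

Set Implicit Arguments.
Unset Strict Implicit.
Unset Printing Implicit Defensive.

(** Analyticity is given as local expansion in power series, so the two tools of
    the classical proof, termwise differentiation and Cauchy's inequalities,
    come first.

    Termwise differentiation ([pderiv_expands]) keeps both the centre and the
    polydisc of an expansion.  Hence [mderiv K F] has the coefficients
    [(M + K)! / M! * c (M + K)], in whatever order the derivatives are taken,
    and [mderiv K F a = K! * c K] at the centre [a].

    Let [F] have index at most [m], and join [z0] to a point [z] of its polydisc
    by a segment.  Along the segment, differentiating a derivative of order at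
    most [m] gives a combination of derivatives of order at most [m.+1], which
    the index bounds by those of order at most [m] at the same point; the ratios
    of values of [L] on the polydisc are bounded because [L] is of class Q.  The
    derivatives of order at most [m], normalized by [L z0], thus satisfy a linear
    differential inequality whose constant does not depend on [z0] and [z], and
    Gronwall's lemma bounds them at [z] by their values at [z0]
    ([normalized_deriv_growth]); [K0] is the multi-index of the largest.

    Conversely, [beta > sqrt n] leaves room for radii [(rho, ..., rho)] of norm
    at most [beta] with [rho > 1].  If [|F| <= M] on the polydisc of radii
    [rho / L z0], then by Cauchy's inequality ([cauchy_estimate]) the normalized
    derivative [J] at [z0] is at most [M / rho ^ |J|].  As [M] is at most [p0]
    times the normalized derivative [K0], the latter dominates all those of
    order [|J|] with [p0 <= rho ^ |J|]; and the order of [K0] is bounded.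

    Cauchy's inequality is obtained without integration.  Averaging
    [F (z0 + t r eta)] over the points [eta] whose coordinates are [N]-th roots
    of unity, against a character, singles out the coefficient [K]: the average
    is [c_K r^K t^|K|] up to [O(t^(|K| + 3))] at [0], and at most [M] in modulus
    for [|t| = 1].  Divided by [t^|K|], it has the value [c_K r^K] at [0], which
    the maximum principle [peano2_max_modulus] bounds by [M].  That principle
    asks for a second-order Taylor expansion at each point of the disc. *)

(** * The modulus of complex numbers *)

Local Notation modulus := Normc.normc.

Section Modulus.
Variable R : realType.
Implicit Types x y z : R[i].

Lemma normCE z : `|z| = (modulus z)%:C%C.
Proof. by []. Qed.

Lemma modulus_ge0 z : 0 <= modulus z.
Proof. by case: z => a b; rewrite /= sqrtr_ge0. Qed.

Lemma modulusD x y : modulus (x + y) <= modulus x + modulus y.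
Proof. exact: le_normcD. Qed.

Lemma modulusN x : modulus (- x) = modulus x.
Proof. exact: normcN. Qed.

Lemma modulusB x y : modulus (x - y) = modulus (y - x).
Proof. by rewrite -modulusN opprB. Qed.

Lemma modulus_real (r : R) : modulus r%:C%C = `|r|.
Proof. by rewrite /= expr0n /= addr0 sqrtr_sqr. Qed.

Lemma modulus_nat k : modulus (k%:R : R[i]) = k%:R.
Proof.
have -> : (k%:R : R[i]) = (k%:R : R)%:C%C by rewrite rmorph_nat.
by rewrite modulus_real normr_nat.
Qed.

Lemma modulusX x k : modulus (x ^+ k) = modulus x ^+ k.
Proof.
elim: k => [|k IH]; first by rewrite !expr0 Normc.normc1.
by rewrite !exprS Normc.normcM IH.
Qed.

Lemma modulus_prod I (s : seq I) (f : I -> R[i]) :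
  modulus (\prod_(k <- s) f k) = \prod_(k <- s) modulus (f k).
Proof.
by elim/big_rec2: _ => [|k y z _ <-]; rewrite ?Normc.normc1 ?Normc.normcM.
Qed.

Lemma modulus_sum I (s : seq I) (P : pred I) (f : I -> R[i]) :
  modulus (\sum_(k <- s | P k) f k) <= \sum_(k <- s | P k) modulus (f k).
Proof.
elim/big_rec2: _ => [|k y z _ yz]; first by rewrite Normc.normc0.
exact: le_trans (modulusD _ _) (lerD (lexx _) yz).
Qed.

Lemma complex_ReB x y : complex.Re (x - y) = complex.Re x - complex.Re y.
Proof. by case: x y => a b [c d]. Qed.

Lemma complex_ImB x y : complex.Im (x - y) = complex.Im x - complex.Im y.
Proof. by case: x y => a b [c d]. Qed.

Lemma modulus_Re z : `|complex.Re z| <= modulus z.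
Proof.
case: z => a b /=; rewrite -sqrtr_sqr ler_wsqrtr //.
by rewrite lerDl sqr_ge0.
Qed.

Lemma modulus_Im z : `|complex.Im z| <= modulus z.
Proof.
case: z => a b /=; rewrite -sqrtr_sqr ler_wsqrtr //.
by rewrite lerDr sqr_ge0.
Qed.

Lemma modulus_sqr z :
  modulus z ^+ 2 = complex.Re z ^+ 2 + complex.Im z ^+ 2.
Proof. by case: z => a b /=; rewrite sqr_sqrtr ?addr_ge0 ?sqr_ge0. Qed.

Lemma modulus_le_ReIm z : modulus z <= `|complex.Re z| + `|complex.Im z|.
Proof.
rewrite -(@ler_pXn2r _ 2) ?nnegrE ?modulus_ge0 ?addr_ge0 // modulus_sqr.
rewrite sqrrD !real_normK ?num_real // -addrA lerD2l.
by rewrite lerDr mulrn_wge0 // mulr_ge0.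
Qed.

Lemma modulus_eq0 z : (modulus z == 0) = (z == 0).
Proof.
by apply/eqP/eqP => [/Normc.eq0_normc//|->]; rewrite Normc.normc0.
Qed.

Lemma modulus_gt0 z : (0 < modulus z) = (z != 0).
Proof. by rewrite lt_def modulus_ge0 andbT modulus_eq0. Qed.

Lemma exprDS (S : comNzRingType) (x y : S) (m : nat) :
  (x + y) ^+ m.+1 = x ^+ m.+1 + m.+1%:R * (x ^+ m * y) +
    \sum_(i < m) (x ^+ (m.+1 - i.+2) * y ^+ i.+2) *+ 'C(m.+1, i.+2).
Proof.
rewrite exprDn big_ord_recl big_ord_recl /= /bump /= ?add1n.
rewrite subn0 expr0 mulr1 bin0 mulr1n subn1 /= expr1 bin1 addrA.
by rewrite -[_ *+ m.+1]mulr_natl.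
Qed.

(** The binomial expansion of [(u + h) ^+ m] has nonnegative weights, so that
    scaling [h] up to modulus [s] bounds its terms of order two and more
    uniformly in [m]. *)
Lemma modulus_expr_remainder (u h : R[i]) (s : R) (m : nat) :
  0 < s -> modulus h <= s ->
  modulus ((u + h) ^+ m - u ^+ m - h * (m%:R * u ^+ m.-1)) <=
  (modulus h / s) ^+ 2 * (modulus u + s) ^+ m.
Proof.
move=> s0 hs; set q := modulus h / s.
have q0 : 0 <= q by rewrite divr_ge0 ?modulus_ge0 // ltW.
have q1 : q <= 1 by rewrite ler_pdivrMr // mul1r.
have hE : modulus h = q * s by rewrite /q divfK // gt_eqF.
case: m => [|m].
  rewrite !expr0 mul0r mulr0 subrr subr0 Normc.normc0 mulr1.
  exact: exprn_ge0.
rewrite !exprDS /=; set tail := \sum_(i < m) _.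
have -> : u ^+ m.+1 + m.+1%:R * (u ^+ m * h) + tail - u ^+ m.+1 -
    h * (m.+1%:R * u ^+ m) = tail by ring.
rewrite {}/tail.
apply: le_trans (modulus_sum _ _ _) _.
rewrite mulrDr -[leLHS]add0r lerD //.
  rewrite mulr_ge0 ?exprn_ge0 // addr_ge0 ?exprn_ge0 ?modulus_ge0 //.
  by rewrite !mulr_ge0 ?ler0n ?exprn_ge0 ?modulus_ge0 ?(ltW s0).
rewrite mulr_sumr ler_sum // => i _.
rewrite -[(_ * _) *+ _]mulr_natl Normc.normcM modulus_nat Normc.normcM !modulusX.
rewrite -[X in _ <= _ * X]mulr_natl [leRHS]mulrCA ler_wpM2l ?ler0n //.
rewrite [leRHS]mulrCA ler_wpM2l ?exprn_ge0 ?modulus_ge0 //.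
rewrite hE exprMn ler_wpM2r ?exprn_ge0 ?(ltW s0) //.
by rewrite -addn2 exprD ler_piMl ?exprn_ge0 // exprn_ile1.
Qed.

Lemma modulus_deriv_expr (u : R[i]) (s : R) (m : nat) : 0 < s ->
  modulus (m.+1%:R * u ^+ m) <= (modulus u + s) ^+ m.+1 / s.
Proof.
move=> s0; rewrite ler_pdivlMr // Normc.normcM modulus_nat modulusX.
rewrite exprDS mulrA addrAC lerDr addr_ge0 ?exprn_ge0 ?modulus_ge0 //.
by apply: sumr_ge0 => i _; rewrite mulrn_wge0 // mulr_ge0 ?exprn_ge0 //
  ?modulus_ge0 ?(ltW s0).
Qed.

End Modulus.

(** * Multi-indices *)

Section Enumeration.
Variable n : nat.
Implicit Types M K : multiindex n.

(** The ranges of the sums and maxima over [{ffun 'I_n -> 'I_N.+1}] as lists of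
    multi-indices, whose type does not depend on the bound [N]. *)
Definition mi_upto N : seq (multiindex n) :=
  [seq mi_of K | K : {ffun 'I_n -> 'I_N.+1} <- index_enum {ffun 'I_n -> 'I_N.+1} &
     (mi_norm (mi_of K) <= N)%N].

Lemma mi_of_inj m : injective (@mi_of n m).
Proof.
move=> K K' /ffunP e; apply/ffunP => j; apply/val_inj.
by have := e j; rewrite !ffunE.
Qed.

Lemma mi_upto_uniq N : uniq (mi_upto N).
Proof.
rewrite map_inj_uniq ?filter_uniq ?index_enum_uniq //.
by move=> K K' /mi_of_inj.
Qed.

Lemma mi_le_norm K j : (K j <= mi_norm K)%N.
Proof. by rewrite /mi_norm (bigD1 j) //= leq_addr. Qed.

Lemma mem_mi_upto N K : (K \in mi_upto N) = (mi_norm K <= N)%N.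
Proof.
apply/mapP/idP => [[K' ]|KN]; first by rewrite mem_filter => /andP[? _] ->.
have KE : mi_of [ffun j => inord (K j) : 'I_N.+1] = K.
  apply/ffunP => j; rewrite !ffunE inordK // ltnS.
  exact: leq_trans (mi_le_norm K j) KN.
by exists [ffun j => inord (K j)]; rewrite ?KE // mem_filter KE KN mem_index_enum.
Qed.

Lemma big_mi_upto (T : Type) (idx : T) (op : Monoid.com_law idx) N (f : multiindex n -> T) :
  \big[op/idx]_(K : {ffun 'I_n -> 'I_N.+1} | (mi_norm (mi_of K) <= N)%N) f (mi_of K) =
  \big[op/idx]_(K <- mi_upto N) f K.
Proof. by rewrite big_map big_filter. Qed.

Definition madd M K : multiindex n := [ffun j => (M j + K j)%N].
Definition munit (i : 'I_n) : multiindex n := [ffun j => (j == i) : nat].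
Definition mi_zero : multiindex n := [ffun j => 0%N].

Lemma mi_normD M K : mi_norm (madd M K) = (mi_norm M + mi_norm K)%N.
Proof. by rewrite /mi_norm -big_split; apply: eq_bigr => j _; rewrite ffunE. Qed.

Lemma mi_norm_unit i : mi_norm (munit i) = 1%N.
Proof.
rewrite /mi_norm (bigD1 i) //= ffunE eqxx big1 // => j /negbTE ji.
by rewrite ffunE ji.
Qed.

Lemma mi_norm0 : mi_norm mi_zero = 0%N.
Proof. by rewrite /mi_norm big1 // => j _; rewrite ffunE. Qed.

Lemma mi_norm_eq0 K : mi_norm K = 0%N -> K = mi_zero.
Proof.
move=> K0; apply/ffunP => j; rewrite ffunE; apply/eqP.
by rewrite -leqn0 -K0 mi_le_norm.
Qed.

Lemma maddC M K : madd M K = madd K M.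
Proof. by apply/ffunP => j; rewrite !ffunE addnC. Qed.

Lemma madd0 M : madd M mi_zero = M.
Proof. by apply/ffunP => j; rewrite !ffunE addn0. Qed.

Lemma madd_inj K : injective (madd^~ K).
Proof.
move=> M M' /ffunP e; apply/ffunP => j.
by have := e j; rewrite !ffunE => /addIn.
Qed.

Lemma madd_munitP K i : (0 < K i)%N -> exists M, K = madd M (munit i).
Proof.
move=> Ki; exists [ffun j => (K j - (j == i))%N]; apply/ffunP => j.
rewrite !ffunE; case: eqP => [->|_]; first by rewrite subnK.
by rewrite subn0 addn0.
Qed.

Lemma mi_upto0 : mi_upto 0 = [:: mi_zero].
Proof.
apply: perm_small_eq => //; apply: uniq_perm => //; first exact: mi_upto_uniq.
move=> K; rewrite mem_mi_upto inE leqn0.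
by apply/eqP/eqP => [/mi_norm_eq0|->] //; rewrite mi_norm0.
Qed.

Lemma big_mi_upto_shift (T : Type) (idx : T) (op : Monoid.com_law idx) N i
    (f : multiindex n -> T) :
  \big[op/idx]_(M <- mi_upto N) f (madd M (munit i)) =
  \big[op/idx]_(K <- mi_upto N.+1 | (0 < K i)%N) f K.
Proof.
rewrite -[LHS](big_map (madd^~ (munit i)) predT) -[RHS]big_filter.
apply: perm_big; apply: uniq_perm.
- rewrite map_inj_uniq ?mi_upto_uniq //; exact: madd_inj.
- by rewrite filter_uniq // mi_upto_uniq.
move=> K; rewrite mem_filter mem_mi_upto; apply/mapP/andP => [[M]|[Ki KN]].
  rewrite mem_mi_upto => MN ->; rewrite mi_normD mi_norm_unit addn1 ltnS MN.
  by rewrite !ffunE eqxx addn1.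
have [M KE] := madd_munitP Ki; exists M => //.
by move: KN; rewrite KE mi_normD mi_norm_unit addn1 ltnS mem_mi_upto.
Qed.

Lemma mi_powE (S : comNzRingType) (w : 'rV[S]_n) K :
  mi_pow w K = \prod_(j < n) w ord0 j ^+ K j.
Proof. by []. Qed.

Lemma mi_powZ (S : comNzRingType) (x : S) (w : 'rV[S]_n) K :
  mi_pow (x *: w) K = x ^+ mi_norm K * mi_pow w K.
Proof.
rewrite !mi_powE /mi_norm expr_sum -big_split; apply: eq_bigr => j _.
by rewrite mxE exprMn.
Qed.

Lemma mi_pow_const (S : comNzRingType) (x : S) K :
  mi_pow (const_mx x) K = x ^+ mi_norm K.
Proof.
by rewrite mi_powE /mi_norm expr_sum; apply: eq_bigr => j _; rewrite mxE.
Qed.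

Lemma mi_powD (S : comNzRingType) (w : 'rV[S]_n) M K :
  mi_pow w (madd M K) = mi_pow w M * mi_pow w K.
Proof.
by rewrite !mi_powE -big_split; apply: eq_bigr => j _; rewrite ffunE exprD.
Qed.

Lemma mi_pow_unit (S : comNzRingType) (w : 'rV[S]_n) i :
  mi_pow w (munit i) = w ord0 i.
Proof.
rewrite mi_powE (bigD1 i) //= ffunE eqxx expr1 big1 ?mulr1 // => j /negbTE ji.
by rewrite ffunE ji expr0.
Qed.

Lemma mi_pow0 (S : comNzRingType) (w : 'rV[S]_n) : mi_pow w mi_zero = 1.
Proof. by rewrite mi_powE big1 // => j _; rewrite ffunE expr0. Qed.

Lemma mi_pow_at0 (S : comNzRingType) K :
  mi_pow (0 : 'rV[S]_n) K = (K == mi_zero)%:R.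
Proof.
rewrite -[0](scale0r 0) mi_powZ expr0n.
case: eqP => [/mi_norm_eq0 ->|K0]; first by rewrite mi_pow0 mul1r eqxx.
by rewrite mul0r; case: eqP => // KE; rewrite KE mi_norm0 in K0.
Qed.

End Enumeration.

(** * Sums over multi-indices *)

Section Summation.
Variables (R : realType) (n : nat).
Implicit Types (a b : multiindex n -> R[i]) (u v : R[i]).

Definition abs_summable a : Prop :=
  exists B : R, forall N, \sum_(K <- mi_upto n N) modulus (a K) <= B.

(** Limits are taken in [R], through the modulus, and along the degree: this is
    the order of summation in which analyticity is stated, and lowering an index
    by one maps the terms of degree at most [N.+1] to those of degree at most
    [N]. *)
Definition has_sum a v : Prop :=
  forall e : R, 0 < e -> exists N0, forall N, (N0 <= N)%N ->
    modulus (\sum_(K <- mi_upto n N) a K - v) < e.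

Lemma has_sum_le a v u B N1 : has_sum a v ->
  (forall N, (N1 <= N)%N -> modulus (\sum_(K <- mi_upto n N) a K - u) <= B) ->
  modulus (v - u) <= B.
Proof.
move=> av aB; apply/ler_addgt0Pr => e e0.
have [N0 N0P] := av e e0; set N := maxn N0 N1.
have -> : v - u = (\sum_(K <- mi_upto n N) a K - u) - (\sum_(K <- mi_upto n N) a K - v).
  by ring.
apply: le_trans (modulusD _ _) _; rewrite modulusN lerD //.
  by rewrite aB // leq_maxr.
by rewrite ltW // N0P // leq_maxl.
Qed.

Lemma has_sum_unique a u v : has_sum a u -> has_sum a v -> u = v.
Proof.
move=> au av; apply/eqP; rewrite -subr_eq0 -modulus_eq0 eq_le modulus_ge0 andbT.
apply/ler_addgt0Pr => e e0; rewrite add0r.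
have [N0 N0P] := av e e0.
by apply: (has_sum_le (N1 := N0) au) => N NN; rewrite ltW // N0P.
Qed.

Lemma has_sum_lin a b u v (x : R[i]) : has_sum a u -> has_sum b v ->
  has_sum (fun K => a K + x * b K) (u + x * v).
Proof.
move=> au bv e e0.
have x1 : 0 < 1 + modulus x by rewrite ltr_pwDl // modulus_ge0.
have e1 : 0 < e / (1 + modulus x) by rewrite divr_gt0.
have [N0 P0] := au _ e1; have [N1 P1] := bv _ e1.
exists (maxn N0 N1) => N; rewrite geq_max => /andP[/P0 {}P0 /P1 {}P1].
rewrite big_split -mulr_sumr /=.
have -> (s t : R[i]) : s + x * t - (u + x * v) = (s - u) + x * (t - v) by ring.
apply: le_lt_trans (modulusD _ _) _; rewrite Normc.normcM.
rewrite -(@divfK _ (1 + modulus x) _ e) ?gt_eqF // mulrDr mulr1.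
by rewrite ltr_leD // mulrC ler_wpM2r ?modulus_ge0 // ltW.
Qed.

Lemma real_series_cvg (u : nat -> R) (B : R) :
  (forall N, \sum_(k < N) `|u k| <= B) ->
  exists l : R, forall e : R, 0 < e -> exists N0, forall N, (N0 <= N)%N ->
    `|\sum_(k < N) u k - l| < e.
Proof.
move=> uB.
have cn : cvgn [normed series u].
  rewrite /normed_series_of; apply: nondecreasing_is_cvgn.
    apply/nondecreasing_seqP => N; rewrite !seriesEord /= big_ord_recr /=.
    by rewrite lerDl.
  exists B => _ [N _ <-]; rewrite seriesEord; exact: uB.
have := normed_cvg cn => /cvg_ex[l ul]; exists l => e e0.
have /cvgrPdist_lt/(_ e e0)[N0 _ N0P] := ul.
exists N0 => N NN; have := N0P N NN.
by rewrite seriesEord distrC.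
Qed.

(** Grouping the terms by degree turns a sum over multi-indices into an
    ordinary series. *)
Lemma sum_mi_upto_degree N (T : zmodType) (f : multiindex n -> T) :
  \sum_(K <- mi_upto n N) f K =
  \sum_(k < N.+1) \sum_(K <- mi_upto n k | mi_norm K == k) f K.
Proof.
elim: N => [|N IH].
  rewrite big_ord_recl big_ord0 addr0 big_seq_cond [RHS]big_seq_cond.
  apply: eq_bigl => K; rewrite mem_mi_upto leqn0 andbT.
  by rewrite andbb.
rewrite big_ord_recr -IH /= (bigID (fun K => mi_norm K == N.+1)) /= addrC.
congr (_ + _); rewrite -[LHS]big_filter; apply: perm_big; apply: uniq_perm.
- by rewrite filter_uniq // mi_upto_uniq.
- exact: mi_upto_uniq.
by move=> K; rewrite mem_filter !mem_mi_upto -ltn_neqAle ltnS.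
Qed.

Lemma abs_summable_has_sum a : abs_summable a -> exists v, has_sum a v.
Proof.
move=> [B aB].
have part (g : R[i] -> R) : (forall x y, g (x + y) = g x + g y) -> g 0 = 0 ->
    (forall x, `|g x| <= modulus x) ->
  exists l : R, forall e : R, 0 < e -> exists N0, forall N, (N0 <= N)%N ->
    `|g (\sum_(K <- mi_upto n N) a K) - l| < e.
  move=> gD g0 gle.
  have gS N : g (\sum_(K <- mi_upto n N) a K) =
      \sum_(k < N.+1) g (\sum_(K <- mi_upto n k | mi_norm K == k) a K).
    by rewrite sum_mi_upto_degree (big_morph g gD g0).
  have bnd N : \sum_(k < N) `|g (\sum_(K <- mi_upto n k | mi_norm K == k) a K)| <= B.
    case: N => [|N].
      rewrite big_ord0; apply: le_trans (aB 0%N).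
      by apply: sumr_ge0 => K _; apply: modulus_ge0.
    apply: le_trans (aB N); rewrite sum_mi_upto_degree ler_sum // => k _.
    exact: le_trans (gle _) (modulus_sum _ _ _).
  have [l lP] := real_series_cvg
    (u := fun k => g (\sum_(K <- mi_upto n k | mi_norm K == k) a K)) bnd.
  exists l => e e0; have [N0 N0P] := lP e e0; exists N0 => N NN.
  by rewrite gS N0P // ltnW.
have [x xP] := part _ (@raddfD _ _ (@complex.Re R)) erefl (@modulus_Re R).
have [y yP] := part _ (@raddfD _ _ (@complex.Im R)) erefl (@modulus_Im R).
exists (x +i* y)%C => e e0.
have e2 : 0 < e / 2 by rewrite divr_gt0.
have [N0 N0P] := xP _ e2; have [N1 N1P] := yP _ e2.
exists (maxn N0 N1) => N; rewrite geq_max => /andP[NN0 NN1].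
apply: le_lt_trans (modulus_le_ReIm _) _; rewrite complex_ReB complex_ImB /=.
by rewrite [ltRHS](splitr e) ltrD // ?N0P ?N1P.
Qed.

End Summation.

(** * Power series and their derivatives *)

(** Over an arbitrary number field, so as to serve both complex partial
    derivatives and derivatives in a real parameter. *)
Lemma cvg_diffq_of_quadratic (K : numFieldType) (V : normedModType K)
    (f : V -> K^o) (a v : V) (d C s : K) : 0 <= C -> 0 < s ->
  (forall h : K, `|h| <= s ->
     `|f (h *: v + a) - f a - h * d| <= C * `|h| ^+ 2) ->
  h^-1 *: ((f \o shift a) (h *: v) - f a) @[h --> 0^'] --> (d : K^o).
Proof.
move=> C0 s0 H; apply/cvgrPdist_lt => e e0.
have C1 : 0 < C + 1 by rewrite ltr_wpDl.
near=> h.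
have h0 : h != 0 by near: h; exact: nbhs_dnbhs_neq.
have hs : `|h| < s by near: h; exact: dnbhs0_lt.
have : `|h| < e / (C + 1) by near: h; apply: dnbhs0_lt; rewrite divr_gt0.
rewrite ltr_pdivlMr // distrC => he.
rewrite /= /shift /=; set X := f _ - f a.
rewrite -[h^-1 *: X]/(h^-1 * X).
have hm : 0 < `|h| by rewrite normr_gt0.
rewrite -(ltr_pM2l hm) -normrM.
have -> : h * (h^-1 * X - d) = X - h * d by rewrite mulrBr mulVKf.
apply: le_lt_trans (H h (ltW hs)) _.
rewrite expr2 mulrA mulrC ltr_pM2l // mulrC; apply: le_lt_trans he.
by rewrite ler_wpM2l ?lerDl // ltW.
Unshelve. all: by end_near.
Qed.

Section PowerSeries.
Variables (R : realType) (n : nat).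
Implicit Types (c : multiindex n -> R[i]) (f : 'rV[R[i]]_n -> R[i]).
Implicit Types (a w : 'rV[R[i]]_n) (r s : R).

Definition expands f a r c : Prop :=
  0 < r /\ forall w, (forall j, modulus (w ord0 j) < r) ->
    abs_summable (fun K => c K * mi_pow w K) /\
    has_sum (fun K => c K * mi_pow w K) (f (a + w)).

Lemma analytic_expands f a : analytic_on_uball f -> uball a ->
  exists c r, expands f a r c.
Proof.
move=> fA aB; have [c [r [r0 H]]] := fA a aB.
exists c, r; split=> // w wr.
have [|esumf cvgf] := H (a + w).
  by move=> j; rewrite mxE [a ord0 j + _]addrC addrK.
rewrite [a + w]addrC addrK [w + a]addrC in esumf cvgf; split.
  have [B HB] : exists B : R, (\esum_(K in [set: multiindex n])
      (modulus (c K * mi_pow w K))%:E <= B%:E)%E.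
    case: (\esum_(_ in _) _)%E esumf => [B _| |] //; first by exists B.
    by exists 0; rewrite leNye.
  exists B => N; rewrite -lee_fin; apply: le_trans HB; apply: esum_ge.
  exists [set` mi_upto n N]; first by split => //; exact: finite_seq.
  by rewrite -fsbig_seq ?mi_upto_uniq // sumEFin.
move=> e e0; move/cvgrPdist_lt : cvgf => /(_ e%:C%C).
rewrite ltcR => /(_ e0)[N0 _ N0P]; exists N0 => N NN.
have := N0P N NN; rewrite /= normCE ltcR modulusB.
by rewrite -(big_mi_upto _ N (fun K => c K * mi_pow w K)).
Qed.

Lemma derive_eq_of_quadratic f a v d (C s : R) : 0 <= C -> 0 < s ->
  (forall h, modulus h <= s ->
     modulus (f (h *: v + a) - f a - h * d) <= C * modulus h ^+ 2) ->
  'D_v f a = d.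
Proof.
move=> C0 s0 H; rewrite /derive; apply: cvg_lim => //.
apply: (@cvg_diffq_of_quadratic _ _ f a v d C%:C%C s%:C%C).
- by rewrite lecR.
- by rewrite ltcR.
move=> h; rewrite normCE lecR => /H.
by rewrite -lecR rmorphM rmorphXn.
Qed.

Definition coef_deriv (j : 'I_n) c : multiindex n -> R[i] :=
  fun M => (M j).+1%:R * c (madd M (munit j)).

Definition set_coord w j (x : R[i]) : 'rV[R[i]]_n :=
  \row_i (if i == j then x else w ord0 i).

Lemma mi_pow_set_coord w j x K : mi_pow (set_coord w j x) K =
  (\prod_(i < n | i != j) w ord0 i ^+ K i) * x ^+ K j.
Proof.
rewrite mi_powE (bigD1 j) //= mxE eqxx mulrC; congr (_ * _).
by apply: eq_bigr => i /negbTE ij; rewrite mxE ij.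
Qed.

Lemma set_coord_id w j : set_coord w j (w ord0 j) = w.
Proof. by apply/rowP => i; rewrite mxE; case: eqP => [->|]. Qed.

Lemma set_coord_add w j h : set_coord w j (w ord0 j + h) = h *: delta_mx ord0 j + w.
Proof.
apply/rowP => i; rewrite !mxE eqxx /=; case: eqP => [->|_].
  by rewrite mulr1 addrC.
by rewrite mulr0 add0r.
Qed.

(** Convergence is still absolute when the coordinate [j] has its modulus
    increased by a small [s].  By [modulus_expr_remainder] this bounds the sum
    of the remainders of all the monomials by a multiple of [|h| ^ 2]. *)
Lemma pderiv_expands f a r c j :
  expands f a r c -> expands (pderiv j f) a r (coef_deriv j c).
Proof.
move=> [r0 H]; split=> // w wr; set u := w ord0 j.
set s := (r - modulus u) / 2.
have s0 : 0 < s by rewrite divr_gt0 // subr_gt0 wr.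
set rho := modulus u + s.
have rho_r : rho < r by rewrite /rho /s; have := wr j; rewrite -/u; lra.
have rho0 : 0 <= rho by rewrite addr_ge0 ?modulus_ge0 // ltW.
have set_coord_lt x : modulus x <= rho -> forall i, modulus (set_coord w j x ord0 i) < r.
  move=> xr i; rewrite mxE; case: eqP => // _; exact: le_lt_trans xr _.
pose T K := c K * \prod_(i < n | i != j) w ord0 i ^+ K i.
have TE x K : c K * mi_pow (set_coord w j x) K = T K * x ^+ K j.
  by rewrite mi_pow_set_coord mulrA.
have [|[B HB] _] := H (set_coord w j rho%:C%C).
  by apply: set_coord_lt; rewrite modulus_real ger0_norm.
have {}HB N : \sum_(K <- mi_upto n N) modulus (T K) * rho ^+ K j <= B.
  apply: le_trans (HB N); apply: ler_sum => K _.
  by rewrite TE [modulus (T K * _)]Normc.normcM modulusX modulus_real ger0_norm.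
pose D K := T K * ((K j)%:R * u ^+ (K j).-1).
have DE M : coef_deriv j c M * mi_pow w M = D (madd M (munit j)).
  rewrite -[in mi_pow w M](set_coord_id w j) mi_pow_set_coord -/u /D /T /coef_deriv.
  rewrite !ffunE eqxx addn1 /=.
  have -> : \prod_(i < n | i != j) w ord0 i ^+ (madd M (munit j)) i =
            \prod_(i < n | i != j) w ord0 i ^+ M i.
    by apply: eq_bigr => i /negbTE ij; rewrite !ffunE ij addn0.
  by ring.
have DS N : \sum_(M <- mi_upto n N) coef_deriv j c M * mi_pow w M =
            \sum_(K <- mi_upto n N.+1) D K.
  under eq_bigr => M _ do rewrite DE.
  rewrite (big_mi_upto_shift _ _ j) [RHS](bigID (fun K : multiindex n => 0 < K j)%N) /=.
  rewrite [X in _ = _ + X]big1 ?addr0 // => K; rewrite -eqn0Ngt => /eqP Kj.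
  by rewrite /D Kj mul0r mulr0.
have sumD : abs_summable (fun M : multiindex n => coef_deriv j c M * mi_pow w M).
  exists (B / s) => N.
  apply: le_trans (_ : \sum_(K <- mi_upto n N.+1) modulus (T K) * rho ^+ K j / s <= _).
    under eq_bigr => M _ do rewrite DE.
    rewrite (big_mi_upto_shift _ _ j (fun K => modulus (D K))).
    rewrite [leRHS](bigID (fun K : multiindex n => 0 < K j)%N) /= ler_wpDr //.
      apply: sumr_ge0 => K _.
      apply: divr_ge0 (ltW s0); apply: mulr_ge0 (modulus_ge0 _) _.
      exact: exprn_ge0.
    apply: ler_sum => K Kj; rewrite /D Normc.normcM -mulrA.
    rewrite ler_wpM2l ?modulus_ge0 // -(prednK Kj).
    exact: modulus_deriv_expr.
  by rewrite -mulr_suml ler_wpM2r ?HB // invr_ge0 ltW.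
split=> //.
have [d dP] := abs_summable_has_sum sumD.
suff -> : pderiv j f (a + w) = d by [].
apply: (@derive_eq_of_quadratic _ _ _ _ (B / s ^+ 2) s) => //.
  rewrite divr_ge0 ?exprn_ge0 ?(ltW s0) //; apply: le_trans (HB 0%N).
  by apply: sumr_ge0 => K _; rewrite mulr_ge0 ?modulus_ge0 ?exprn_ge0.
move=> h hs.
have fE x : modulus x <= rho -> has_sum (fun K => T K * x ^+ K j) (f (a + set_coord w j x)).
  move=> xr; have [_] := H _ (set_coord_lt x xr).
  by under eq_fun => K do rewrite TE.
rewrite addrCA -set_coord_add -/u.
rewrite -[X in _ - f (a + X) - _](set_coord_id w j) -/u.
have hu : modulus (u + h) <= rho.
  by apply: le_trans (modulusD _ _) _; rewrite lerD2l.
have uu : modulus u <= rho by rewrite lerDl ltW.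
have DsumD : has_sum D d.
  move=> e /dP[N0 N0P]; exists N0.+1 => -[//|N] NN.
  by rewrite -DS N0P.
(* Sum the remainders of the monomials, which are increments in [h] minus their
   linear parts. *)
have := has_sum_lin (- h) (has_sum_lin (-1) (fE _ hu) (fE _ uu)) DsumD.
rewrite mulN1r mulNr => hS.
rewrite -[X in modulus X]subr0; apply: (has_sum_le (N1 := 0%N) hS) => N _.
rewrite subr0; apply: le_trans (modulus_sum _ _ _) _.
apply: le_trans (_ : \sum_(K <- mi_upto n N) (modulus h / s) ^+ 2 *
    (modulus (T K) * rho ^+ K j) <= _).
  apply: ler_sum => K _.
  have -> : T K * (u + h) ^+ K j + -1 * (T K * u ^+ K j) + - h * D K =
      T K * ((u + h) ^+ K j - u ^+ K j - h * ((K j)%:R * u ^+ (K j).-1)).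
    by rewrite /D; ring.
  rewrite [leLHS]Normc.normcM [leRHS]mulrCA ler_wpM2l ?modulus_ge0 //.
  exact: modulus_expr_remainder.
rewrite -mulr_sumr expr_div_n mulrC mulrA mulrAC.
rewrite ler_wpM2r ?exprn_ge0 ?modulus_ge0 //.
by rewrite ler_wpM2r ?HB // invr_ge0 exprn_ge0 // ltW.
Qed.

Lemma iter_pderiv_expands f a r c i k : expands f a r c ->
  expands (iter k (pderiv i) f) a r
    (fun M : multiindex n => ((M i + k) ^_ k)%:R * c (madd M [ffun j => (k * (j == i))%N])).
Proof.
move=> fc; elim: k => [|k /pderiv_expands-/(_ i) IH] /=.
  have -> // : (fun M : multiindex n => ((M i + 0) ^_ 0)%:R *
      c (madd M [ffun j => (0 * (j == i))%N])) = c.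
  apply/funext => M; rewrite ffactn0 mul1r; congr c.
  by apply/ffunP => j; rewrite !ffunE addn0.
congr (expands _ _ _ _): IH; apply/funext => M.
rewrite /coef_deriv !ffunE eqxx mulrA -natrM addn1 addSnnS ffactnSr.
rewrite -addSnnS addnK mulnC; congr (_ * c _).
by apply/ffunP => j; rewrite !ffunE -addnA; congr (_ + _)%N.
Qed.

Definition coef_mderiv (K : multiindex n) c : multiindex n -> R[i] :=
  fun M => (\prod_(j < n) (M j + K j) ^_ (K j))%:R * c (madd M K).

(** The derivative [K] of a power series has the same coefficients in whatever
    order the partial derivatives are taken, which is how mixed partial
    derivatives of analytic functions are seen to commute. *)
Lemma mderiv_expands f a r c K :
  expands f a r c -> expands (mderiv K f) a r (coef_mderiv K c).
Proof.
move=> fc; rewrite /mderiv.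
pose rK (s : seq 'I_n) : multiindex n := [ffun j => (K j * (j \in s))%N].
have IH (s : seq 'I_n) : uniq s ->
  expands (foldr (fun j G => iter (K j) (pderiv j) G) f s) a r
    (fun M : multiindex n => (\prod_(j <- s) (M j + K j) ^_ (K j))%:R * c (madd M (rK s))).
  elim: s => [_|i s IH /= /andP[is_ us]] /=.
    congr (expands _ _ _ _): fc; apply/funext => M.
    rewrite big_nil mul1r; congr c.
    by apply/ffunP => j; rewrite !ffunE muln0 addn0.
  have := iter_pderiv_expands i (K i) (IH us).
  congr (expands _ _ _ _); apply/funext => M.
  rewrite big_cons natrM -mulrA; congr (_ * (_ * _)).
    congr (_%:R); apply: eq_big_seq => j js.
    have /negbTE ji : j != i by apply: contraNneq is_ => <-.
    by rewrite !ffunE ji muln0 addn0.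
  congr c; apply/ffunP => j; rewrite !ffunE -addnA inE; congr (_ + _)%N.
  by case: eqP => [->|_] /=; rewrite ?(negbTE is_) ?muln0 ?addn0.
have := IH _ (enum_uniq 'I_n); congr (expands _ _ _ _); apply/funext => M.
rewrite /coef_mderiv big_enum /=; congr (_ * c (madd M _)).
by apply/ffunP => j; rewrite ffunE mem_enum muln1.
Qed.

Lemma expands_center f a r c : expands f a r c -> f a = c (mi_zero n).
Proof.
move=> [r0 H]; have [|_] := H 0.
  by move=> j; rewrite mxE Normc.normc0.
rewrite addr0 => /has_sum_unique; apply => e e0; exists 0%N => N _.
rewrite (bigD1_seq (mi_zero n)) ?mem_mi_upto ?mi_norm0 ?mi_upto_uniq //=.
rewrite mi_pow_at0 eqxx mulr1 big1 ?addr0 ?subrr ?Normc.normc0 // => K /negbTE K0.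
by rewrite mi_pow_at0 K0 mulr0.
Qed.

Lemma mderiv_center f a r c K : expands f a r c ->
  mderiv K f a = (mi_fact K)%:R * c K.
Proof.
move=> /mderiv_expands-/(_ K)/expands_center ->.
rewrite /coef_mderiv maddC madd0; congr (_%:R * _).
by apply: eq_bigr => j _; rewrite ffunE add0n ffactnn.
Qed.

(** Raising [K] by one in the coordinate [j] thus amounts to one more derivative,
    wherever [j] stands in the order of the differentiations in [mderiv]. *)
Lemma coef_mderiv_unit f a r c K j : expands f a r c ->
  coef_mderiv K c (munit j) = mderiv (madd K (munit j)) f a.
Proof.
move=> /mderiv_center ->; rewrite /coef_mderiv maddC /mi_fact; congr (_%:R * _).
rewrite (bigD1 j) // [RHS](bigD1 j) //= !ffunE eqxx add1n addn1.
rewrite -[in RHS]ffactnn ffactnSr subSnn muln1; congr (_ * _)%N.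
by apply: eq_bigr => i /negbTE ij; rewrite !ffunE ij addn0 add0n ffactnn.
Qed.

(** A term of degree more than [q] decays at least like the power [q.+1] of the
    size of its argument; comparing with a fixed polyradius inside the domain
    of convergence sums these terms up. *)
Lemma expands_taylor f a r c q : expands f a r c ->
  exists C s, [/\ 0 <= C, 0 < s & forall sg w, 0 <= sg -> sg <= s ->
    (forall j, modulus (w ord0 j) <= sg) ->
    modulus (f (a + w) - \sum_(K <- mi_upto n q) c K * mi_pow w K) <= C * sg ^+ q.+1].
Proof.
move=> [r0 H]; set s := r / 2.
have s0 : 0 < s by rewrite divr_gt0.
have sr : s < r by rewrite /s; lra.
have [|[B HB] _] := H (const_mx s%:C%C).
  by move=> j; rewrite mxE modulus_real gtr0_norm.
have {}HB N : \sum_(K <- mi_upto n N) modulus (c K) * s ^+ mi_norm K <= B.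
  apply: le_trans (HB N); apply: ler_sum => K _.
  by rewrite mi_pow_const Normc.normcM modulusX modulus_real gtr0_norm.
exists (B / s ^+ q.+1), s; split => //.
  rewrite divr_ge0 ?exprn_ge0 ?(ltW s0) //; apply: le_trans (HB 0%N).
  by apply: sumr_ge0 => K _; rewrite mulr_ge0 ?modulus_ge0 ?exprn_ge0 ?(ltW s0).
move=> sg w sg0 sgs wsg.
have [|_ fw] := H w; first by move=> j; apply: le_lt_trans (wsg j) (le_lt_trans sgs sr).
apply: (has_sum_le (N1 := q) fw) => N qN.
have -> : \sum_(K <- mi_upto n N) c K * mi_pow w K -
    \sum_(K <- mi_upto n q) c K * mi_pow w K =
    \sum_(K <- mi_upto n N | (q < mi_norm K)%N) c K * mi_pow w K.
  rewrite (bigID (fun K : multiindex n => mi_norm K <= q)%N) /=.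
  rewrite -[X in X + _ - _]big_filter.
  have -> : \sum_(K <- [seq K <- mi_upto n N | (mi_norm K <= q)%N]) c K * mi_pow w K =
      \sum_(K <- mi_upto n q) c K * mi_pow w K.
    apply: perm_big; apply: uniq_perm.
    - by rewrite filter_uniq // mi_upto_uniq.
    - exact: mi_upto_uniq.
    move=> K; rewrite mem_filter !mem_mi_upto.
    by case: leqP => //= Kq; rewrite (leq_trans Kq).
  by rewrite addrC addKr; apply: eq_bigl => K; rewrite ltnNge.
apply: le_trans (modulus_sum _ _ _) _.
apply: le_trans (_ : \sum_(K <- mi_upto n N | (q < mi_norm K)%N)
   (sg / s) ^+ q.+1 * (modulus (c K) * s ^+ mi_norm K) <= _).
  apply: ler_sum => K qK; rewrite Normc.normcM [leRHS]mulrCA.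
  rewrite ler_wpM2l ?modulus_ge0 //.
  apply: le_trans (_ : sg ^+ mi_norm K <= _).
    rewrite mi_powE modulus_prod /mi_norm expr_sum.
    apply: ler_prod => j _; rewrite modulusX exprn_ge0 ?modulus_ge0 //=.
    by rewrite lerXn2r ?nnegrE ?modulus_ge0.
  rewrite -(subnKC qK) [in leRHS]exprD mulrA -exprMn divfK ?gt_eqF // exprD.
  by rewrite ler_wpM2l ?exprn_ge0 // lerXn2r ?nnegrE // ltW.
rewrite -mulr_sumr expr_div_n mulrC mulrA mulrAC.
rewrite ler_wpM2r ?exprn_ge0 // ler_wpM2r ?invr_ge0 ?exprn_ge0 ?(ltW s0) //.
apply: le_trans (HB N); rewrite [leRHS](bigID (fun K : multiindex n => q < mi_norm K)%N) /=.
rewrite lerDl sumr_ge0 // => K _.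
by rewrite mulr_ge0 ?modulus_ge0 ?exprn_ge0 ?(ltW s0).
Qed.

End PowerSeries.

(** * Polydiscs in the unit ball *)

Section Euclid.
Variables (R : realType) (n : nat).
Implicit Types (u v : 'rV[R]_n).

Lemma enorm_ge0 v : 0 <= enorm v.
Proof. exact: sqrtr_ge0. Qed.

Lemma sum_sqr_ge0 v : 0 <= \sum_(j < n) v ord0 j ^+ 2.
Proof. by apply: sumr_ge0 => j _; rewrite sqr_ge0. Qed.

Lemma enorm_sqr v : enorm v ^+ 2 = \sum_(j < n) v ord0 j ^+ 2.
Proof. by rewrite sqr_sqrtr // sum_sqr_ge0. Qed.

Lemma enorm_le u v : (forall j, 0 <= u ord0 j) ->
  (forall j, u ord0 j <= v ord0 j) -> enorm u <= enorm v.
Proof.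
move=> u0 uv; rewrite ler_wsqrtr // ler_sum // => j _.
by rewrite lerXn2r ?nnegrE // (le_trans (u0 j)).
Qed.

Lemma enormZ (x : R) v : 0 <= x -> enorm (x *: v) = x * enorm v.
Proof.
move=> x0; rewrite /enorm -[X in X * _](ger0_norm x0) -sqrtr_sqr -sqrtrM ?sqr_ge0 //.
by rewrite mulr_sumr; congr Num.sqrt; apply: eq_bigr => j _; rewrite mxE exprMn.
Qed.

Lemma enorm_const (x : R) : 0 <= x -> enorm (const_mx x : 'rV[R]_n) = Num.sqrt n%:R * x.
Proof.
move=> x0; rewrite /enorm (eq_bigr (fun=> x ^+ 2)) => [|j _]; last by rewrite mxE.
rewrite sumr_const card_ord -[_ ^+ 2 *+ _]mulr_natl sqrtrM ?ler0n // sqrtr_sqr.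
by rewrite ger0_norm.
Qed.

Lemma cauchy_schwarz u v :
  \sum_(j < n) u ord0 j * v ord0 j <= enorm u * enorm v.
Proof.
set A := enorm u; set B := enorm v.
have A0 : 0 <= A by apply: enorm_ge0.
have B0 : 0 <= B by apply: enorm_ge0.
have zero (w w' : 'rV[R]_n) : enorm w = 0 -> \sum_(j < n) w ord0 j * w' ord0 j = 0.
  move=> w0; have /eqP := enorm_sqr w; rewrite w0 expr0n /= eq_sym.
  move/eqP => S0; rewrite big1 // => j _.
  have /(_ j isT)/eqP := psumr_eq0P (fun i _ => sqr_ge0 (w ord0 i)) S0.
  by rewrite sqrf_eq0 => /eqP ->; rewrite mul0r.
have [uz|uz] := eqVneq A 0; first by rewrite uz mul0r zero.
have [vz|vz] := eqVneq B 0.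
  by rewrite vz mulr0; under eq_bigr => j _ do rewrite mulrC; rewrite zero.
have AB : 0 < A * B by rewrite mulr_gt0 // lt_def ?uz ?vz.
set S := \sum_(j < n) _.
have : 0 <= \sum_(j < n) (u ord0 j * B - v ord0 j * A) ^+ 2.
  by apply: sumr_ge0 => j _; rewrite sqr_ge0.
have -> : \sum_(j < n) (u ord0 j * B - v ord0 j * A) ^+ 2 =
    (\sum_(j < n) u ord0 j ^+ 2) * B ^+ 2 +
    (\sum_(j < n) v ord0 j ^+ 2) * A ^+ 2 - 2 * (A * B) * S.
  rewrite !mulr_suml mulr_sumr -big_split -sumrB /=.
  by apply: eq_bigr => j _; ring.
rewrite -!enorm_sqr -/A -/B.
have -> : A ^+ 2 * B ^+ 2 + B ^+ 2 * A ^+ 2 - 2 * (A * B) * S =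
  (2 * (A * B)) * (A * B - S) by ring.
by rewrite pmulr_rge0 ?subr_ge0 // mulr_gt0.
Qed.

Lemma enormD u v : enorm (u + v) <= enorm u + enorm v.
Proof.
rewrite -(@ler_pXn2r _ 2) ?nnegrE ?addr_ge0 ?enorm_ge0 //.
rewrite sqrrD !enorm_sqr.
have -> : \sum_(j < n) (u + v) ord0 j ^+ 2 = \sum_(j < n) u ord0 j ^+ 2 +
   (\sum_(j < n) u ord0 j * v ord0 j) *+ 2 + \sum_(j < n) v ord0 j ^+ 2.
  rewrite -sumrMnl -!big_split /=; apply: eq_bigr => j _.
  by rewrite mxE sqrrD.
by rewrite lerD2r lerD2l lerMn2r cauchy_schwarz.
Qed.

Lemma cnorm_polydisc (z0 z : 'rV[R[i]]_n) (v : 'rV[R]_n) : polydisc z0 v z ->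
  cnorm z <= cnorm z0 + enorm v.
Proof.
move=> zv; apply: le_trans (enormD _ _); apply: enorm_le => j.
  by rewrite mxE modulus_ge0.
rewrite !mxE; have -> : z ord0 j = z0 ord0 j + (z ord0 j - z0 ord0 j) by ring.
exact: le_trans (modulusD _ _) (lerD (lexx _) (zv j)).
Qed.

Lemma nbhs_polydisc (z0 : 'rV[R[i]]_n) (e : R) (P : set 'rV[R[i]]_n) : 0 < e ->
  (forall z, polydisc z0 (const_mx e) z -> P z) -> nbhs z0 P.
Proof.
move=> e0 H; apply/nbhs_ballP; exists e%:C%C; first by rewrite /= ltcR.
move=> z [_ zz]; apply: H => j; rewrite mxE ltW //.
have := zz ord0 j; rewrite -ball_normE /= normCE ltcR.
by rewrite modulusB.
Qed.

Lemma uball_open : open (@uball R n).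
Proof.
rewrite openE => z zB.
have d0 : 0 < (1 - cnorm z) / (Num.sqrt n%:R + 1).
  by rewrite divr_gt0 ?subr_gt0 // ltr_wpDl ?sqrtr_ge0.
apply: (nbhs_polydisc d0) => z' /cnorm_polydisc zz'.
apply: le_lt_trans zz' _; rewrite enorm_const ?(ltW d0) //.
rewrite -ltrBrDl mulrCA gtr_pMr ?subr_gt0 //.
by rewrite ltr_pdivrMr ?mul1r ?ltrDl // ltr_wpDl ?sqrtr_ge0.
Qed.

End Euclid.

Section Compact.
Variable (R : realType).

Lemma modulus_dist (x y : R[i]) : `|modulus x - modulus y| <= modulus (x - y).
Proof.
rewrite ler_norml lerBlDr lerNl opprB lerBlDr.
have := modulusD (x - y) y; have := modulusD (y - x) x.
by rewrite !subrK [modulus (y - x)]modulusB => -> ->.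
Qed.

Lemma modulus_sub_continuous (a : R[i]) :
  continuous (fun z : R[i] => modulus (z - a)).
Proof.
move=> z; apply/(@cvgrPdist_lt _ _ _ (nbhs z) (nbhs_filter z)) => e e0.
apply/nbhs_ballP; exists e%:C%C; first by rewrite /= ltcR.
move=> y; rewrite -ball_normE /= normCE ltcR; apply: le_lt_trans.
apply: le_trans (modulus_dist _ _) _.
by have -> : z - a - (y - a) = z - y by ring.
Qed.

Lemma closed_disc_compact (a : R[i]) (r : R) :
  compact [set z : R[i] | modulus (z - a) <= r].
Proof.
pose g (p : R * R) : R[i] := a + (p.1 +i* p.2)%C.
have gc : continuous g.
  move=> p; apply/cvgrPdist_lt => -[e e']; rewrite ltcE /= => /andP[/eqP -> e0].
  have e2 : 0 < e / 2 by rewrite divr_gt0.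
  exists (ball p.1 (e / 2), ball p.2 (e / 2)).
    by split; apply: nbhsx_ballx.
  move=> q []; rewrite -!ball_normE /= => q1 q2.
  rewrite -[(e +i* 0)%C]/(e%:C%C) normCE ltcR.
  have -> : g p - g q = ((p.1 - q.1) +i* (p.2 - q.2))%C.
    by rewrite /g opprD addrACA subrr add0r.
  by apply: le_lt_trans (modulus_le_ReIm _) _; rewrite /= [ltRHS](splitr e) ltrD.
apply: (@subclosed_compact _ _ (g @` (`[- r, r] `*` `[- r, r]))).
- apply: (@preimage_closed _ _ (fun z => modulus (z - a)) [set x | x <= r]).
    by move=> z _; apply: modulus_sub_continuous.
  exact: closed_le.
- apply: continuous_compact; first exact: continuous_subspaceT.
  by apply: compact_setX; apply: segment_compact.
move=> z zr; exists (complex.Re (z - a), complex.Im (z - a)).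
  split; rewrite /= in_itv /= -ler_norml.
    exact: le_trans (modulus_Re _) zr.
  exact: le_trans (modulus_Im _) zr.
by rewrite /g /=; case: (z - a) (subrK a z) => x y <-; rewrite addrC.
Qed.

Lemma polydisc_compact n (z0 : 'rV[R[i]]_n) (v : 'rV[R]_n) :
  compact (polydisc z0 v).
Proof.
apply: (@rV_compact _ n (fun j => [set z | modulus (z - z0 ord0 j) <= v ord0 j])).
by move=> j; apply: closed_disc_compact.
Qed.

Lemma polydisc_max n (z0 : 'rV[R[i]]_n) (v : 'rV[R]_n) (g : 'rV[R[i]]_n -> R) :
  (forall j, 0 <= v ord0 j) ->
  (forall z, polydisc z0 v z -> {for z, continuous g}) ->
  exists2 zm, polydisc z0 v zm & forall z, polydisc z0 v z -> g z <= g zm.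
Proof.
move=> v0 gc.
have [|||zm] := @compact_EVT_max _ _ g (polydisc z0 v).
- by exists z0 => j; rewrite subrr Normc.normc0.
- exact: polydisc_compact.
- by apply: continuous_in_subspaceT => z; rewrite inE => /gc.
rewrite inE => zmP h; exists zm => // z zP; apply: h.
by rewrite inE.
Qed.

End Compact.

(** * Local behaviour of the derivatives *)

Lemma seq_argmax (R : realDomainType) (T : eqType) (s : seq T) (g : T -> R) :
  (exists x, x \in s) -> exists2 x0, x0 \in s & forall x, x \in s -> g x <= g x0.
Proof.
elim: s => [[]//|y [|y' s] IH _].
  by exists y => [|x]; rewrite inE // => /eqP ->.
have [|x0 x0s x0M] := IH; first by exists y'; rewrite inE eqxx.
have [yx|xy] := leP (g y) (g x0).
  exists x0 => [|x]; first by rewrite inE x0s orbT.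
  by rewrite inE => /orP[/eqP ->//|/x0M].
exists y => [|x]; first by rewrite inE eqxx.
rewrite inE => /orP[/eqP ->//|/x0M/le_trans]; apply; exact: ltW.
Qed.

Lemma div_mi_pow_continuous (R : realType) (T : topologicalType) n (z : T)
    (f : T -> R) (l : T -> 'rV[R]_n) (c : R) (K : multiindex n) :
  {for z, continuous f} -> (forall j, {for z, continuous (fun y => l y ord0 j)}) ->
  c * mi_pow (l z) K != 0 -> {for z, continuous (fun y => f y / (c * mi_pow (l y) K))}.
Proof.
move=> fc lc nz; apply: cvgM => //; apply: cvgV => //.
apply: cvgM; first exact: cvg_cst.
rewrite /mi_pow; elim: (index_enum _) => [|j s IH].
  by under eq_fun do rewrite big_nil; rewrite big_nil; apply: cvg_cst.
under eq_fun do rewrite big_cons; rewrite big_cons.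
apply: cvgM => //; elim: (K j) => [|k IHk].
  by under eq_fun do rewrite expr0; rewrite expr0; apply: cvg_cst.
under eq_fun do rewrite exprS; rewrite exprS.
by apply: cvgM => //; apply: lc.
Qed.

Section LocalExpansion.
Variables (R : realType) (n : nat).
Implicit Types (F : 'rV[R[i]]_n -> R[i]) (a w z : 'rV[R[i]]_n).

Lemma sum_mi_upto1 (V : zmodType) (g : multiindex n -> V) :
  \sum_(K <- mi_upto n 1) g K = g (mi_zero n) + \sum_(j < n) g (munit j).
Proof.
have -> : g (mi_zero n) + \sum_(j < n) g (munit j) =
    \sum_(K <- mi_zero n :: [seq munit j | j <- index_enum 'I_n]) g K.
  by rewrite big_cons big_map.
apply: perm_big.
apply: uniq_perm; first exact: mi_upto_uniq.
  rewrite /= map_inj_uniq ?index_enum_uniq ?andbT.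
    by apply/mapP => -[j _ /(congr1 (@mi_norm n))]; rewrite mi_norm0 mi_norm_unit.
  by move=> i j /ffunP/(_ i); rewrite !ffunE eqxx; case: eqP.
move=> K; rewrite mem_mi_upto inE; apply/idP/orP => [|[/eqP->|/mapP[j _ ->]]]; last first.
- by rewrite mi_norm_unit.
- by rewrite mi_norm0.
rewrite leq_eqVlt ltnS leqn0 => /orP[/eqP K1|/eqP/mi_norm_eq0 ->]; last by left.
right; have [j Kj] : exists j, (0 < K j)%N.
  apply/existsP; apply: contra_eqT K1 => /existsPn K0.
  by rewrite /mi_norm big1 // => j _; apply/eqP; rewrite eqn0Ngt.
apply/mapP; exists j; first by rewrite mem_index_enum.
have [M KE] := madd_munitP Kj.
move: K1; rewrite KE mi_normD mi_norm_unit addn1 => -[] /mi_norm_eq0 ->.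
by rewrite maddC madd0.
Qed.

Lemma mderiv_lipschitz F a K : analytic_on_uball F -> uball a ->
  exists C s, [/\ 0 <= C, 0 < s & forall sg w, 0 <= sg -> sg <= s ->
    (forall j, modulus (w ord0 j) <= sg) ->
    modulus (mderiv K F (a + w) - mderiv K F a) <= C * sg].
Proof.
move=> FA aB; have [c [r Fc]] := analytic_expands FA aB.
have [C [s [C0 s0 H]]] := expands_taylor 0 (mderiv_expands K Fc).
exists C, s; split=> // sg w sg0 sgs wsg.
have := H sg w sg0 sgs wsg.
rewrite mi_upto0 big_seq1 mi_pow0 mulr1 expr1.
by rewrite -(expands_center (mderiv_expands K Fc)).
Qed.

Lemma mderiv_differential F a K : analytic_on_uball F -> uball a ->
  exists C s, [/\ 0 <= C, 0 < s & forall sg w, 0 <= sg -> sg <= s ->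
    (forall j, modulus (w ord0 j) <= sg) ->
    modulus (mderiv K F (a + w) - mderiv K F a -
      \sum_(j < n) w ord0 j * mderiv (madd K (munit j)) F a) <= C * sg ^+ 2].
Proof.
move=> FA aB; have [c [r Fc]] := analytic_expands FA aB.
have [C [s [C0 s0 H]]] := expands_taylor 1 (mderiv_expands K Fc).
exists C, s; split=> // sg w sg0 sgs wsg.
have := H sg w sg0 sgs wsg; rewrite sum_mi_upto1 opprD addrA mi_pow0 mulr1.
rewrite -(expands_center (mderiv_expands K Fc)).
congr (modulus (_ - _) <= _); apply: eq_bigr => j _.
by rewrite mi_pow_unit (coef_mderiv_unit _ _ Fc) mulrC.
Qed.

Lemma modulus_mderiv_continuous F a K : analytic_on_uball F -> uball a ->
  {for a, continuous (fun z => modulus (mderiv K F z))}.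
Proof.
move=> FA aB; have [C [s [C0 s0 H]]] := mderiv_lipschitz K FA aB.
apply/(@cvgrPdist_lt _ _ _ (nbhs a) (nbhs_filter a)) => e e0.
have C1 : 0 < C + 1 by rewrite ltr_wpDl.
have m0 : 0 < Num.min s (e / (C + 1)) by rewrite lt_min s0 divr_gt0.
apply: (nbhs_polydisc m0) => z az /=.
have [m1 m2] : Num.min s (e / (C + 1)) <= s /\
    Num.min s (e / (C + 1)) <= e / (C + 1).
  by split; rewrite ge_min lexx ?orbT.
apply: le_lt_trans (modulus_dist _ _) _; rewrite modulusB.
have -> : z = a + (z - a) by rewrite addrC subrK.
apply: le_lt_trans (H _ (z - a) (ltW m0) m1 _) _.
  by move=> j; have := az j; rewrite !mxE.
apply: le_lt_trans (_ : C * (e / (C + 1)) < e); first by rewrite ler_wpM2l.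
by rewrite mulrCA gtr_pMr // ltr_pdivrMr // mul1r ltrDl.
Qed.

End LocalExpansion.

(** * The class Q *)

Section ClassQ.
Variables (R : realType) (n : nat) (beta : R) (L : 'rV[R[i]]_n -> 'rV[R]_n).
Hypotheses (beta0 : 0 < beta) (LQ : classQ beta L).
Implicit Types (F : 'rV[R[i]]_n -> R[i]) (a w z : 'rV[R[i]]_n).
Implicit Types (rad : 'rV[R]_n) (K : multiindex n).

Lemma classQ_gt0 z j : uball z -> 0 < L z ord0 j.
Proof.
move=> zB; have [_ /(_ z j zB)[_] + _] := LQ; apply: lt_trans.
by rewrite divr_gt0 // subr_gt0.
Qed.

Lemma vdiv_ge0 rad z j : (forall j, 0 <= rad ord0 j) -> uball z ->
  0 <= vdiv rad (L z) ord0 j.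
Proof.
by move=> r0 zB; rewrite mxE divr_ge0 ?r0 // ltW // classQ_gt0.
Qed.

(** The radii are [rad / L z0], and [beta / (1 - |z0|) < L z0] makes the nonzero
    ones strictly smaller than those of [rad * (1 - |z0|) / beta], a vector of
    norm at most [1 - |z0|]. *)
Lemma polydisc_sub_uball rad z0 : (forall j, 0 <= rad ord0 j) ->
  enorm rad <= beta -> uball z0 ->
  polydisc z0 (vdiv rad (L z0)) `<=` @uball R n.
Proof.
move=> r0 rb z0B z /cnorm_polydisc; rewrite /uball /= => h.
apply: le_lt_trans h _; rewrite -ltrBrDl; set l := 1 - cnorm z0.
have l0 : 0 < l by rewrite subr_gt0.
have [/existsP[j0 j0P]|rad0] := boolP [exists j, rad ord0 j != 0]; last first.
  rewrite (_ : vdiv _ _ = 0 *: 0) ?enormZ ?mul0r //; apply/rowP => j.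
  rewrite scaler0 !mxE; have /existsPn/(_ j) := rad0.
  by rewrite negbK => /eqP ->; rewrite mul0r.
have lb0 : 0 <= l / beta by rewrite ltW // divr_gt0.
apply: (@lt_le_trans _ _ (enorm ((l / beta) *: rad))); last first.
  by rewrite enormZ // mulrAC ler_pdivrMr // ler_wpM2l // ltW.
have rad_gt0 : 0 < rad ord0 j0 by rewrite lt_def j0P r0.
have lt_vdiv j : 0 < rad ord0 j -> vdiv rad (L z0) ord0 j < ((l / beta) *: rad) ord0 j.
  move=> rj; rewrite !mxE mulrC ltr_pM2r // -invf_div ltf_pV2 ?posrE //.
  - by have [_ /(_ z0 j z0B)[_]] := LQ.
  - exact: classQ_gt0.
  - by rewrite divr_gt0.
have le_vdiv j : vdiv rad (L z0) ord0 j <= ((l / beta) *: rad) ord0 j.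
  have := r0 j; rewrite le_eqVlt => /orP[/eqP rj|/lt_vdiv/ltW//].
  by rewrite !mxE -rj mul0r mulr0.
rewrite ltr_sqrt; last first.
  rewrite (bigD1 j0) //= ltr_pwDl ?sumr_ge0 // => [|j _]; last exact: sqr_ge0.
  by rewrite exprn_gt0 // mxE mulr_gt0 ?divr_gt0.
rewrite (bigD1 j0) //= [ltRHS](bigD1 j0) //= ltr_leD //.
  rewrite ltr_pXn2r ?nnegrE ?vdiv_ge0 ?lt_vdiv //.
  by rewrite mxE mulr_ge0.
by apply: ler_sum => j _; rewrite lerXn2r ?nnegrE ?vdiv_ge0 // mxE mulr_ge0.
Qed.

(** One constant for the finitely many coordinates and for both the suprema and
    the inverses of the infima of the ratios. *)
Lemma classQ_ratio_bound rad : (forall j, 0 <= rad ord0 j) ->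
  enorm rad <= beta ->
  exists2 Lam, 1 <= Lam & forall z0 z, uball z0 ->
    polydisc z0 (vdiv rad (L z0)) z ->
    forall j, L z ord0 j <= Lam * L z0 ord0 j /\ L z0 ord0 j <= Lam * L z ord0 j.
Proof.
move=> r0 rb; have [_ _ /(_ rad r0 rb) lamP] := LQ.
have /fin_all_exists[lam lamE] (j : 'I_n) : exists lam, 0 <= lam /\
  forall z0 z, uball z0 -> polydisc z0 (vdiv rad (L z0)) z ->
    L z ord0 j <= lam * L z0 ord0 j /\ L z0 ord0 j <= lam * L z ord0 j.
  have [l1 _ l2] := lamP j.
  have [l [l0 lP]] : exists l : R, 0 < l /\ (l%:E <= lambda1 L rad j)%E.
    case: (lambda1 L rad j) l1 => [x| |] //; first by rewrite lte_fin => x0; exists x.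
    by exists 1; rewrite leey.
  have [u [u0 uP]] : exists u : R, 0 <= u /\ (lambda2 L rad j <= u%:E)%E.
    case: (lambda2 L rad j) l2 => [x _| |] //.
      by exists `|x|; rewrite lee_fin ler_norm.
    by exists 0; rewrite leNye.
  exists (u + l^-1); split; first by rewrite addr_ge0 // invr_ge0 ltW.
  move=> z0 z z0B zP; have zB := polydisc_sub_uball r0 rb z0B zP.
  have Lz0 := classQ_gt0 j z0B; have Lz := classQ_gt0 j zB.
  have inR : ratio_set L rad j (L z ord0 j / L z0 ord0 j)%:E by exists z0, z.
  have := le_trans lP (ereal_inf_lbound inR).
  have := le_trans (ereal_sup_ubound inR) uP.
  rewrite !lee_fin ler_pdivrMr // ler_pdivlMr // => h1 h2; split.
    by apply: le_trans h1 _; rewrite ler_wpM2r ?(ltW Lz0) // lerDl invr_ge0 ltW.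
  rewrite mulrDl -[leLHS]add0r lerD ?mulr_ge0 ?(ltW Lz) //.
  by rewrite ler_pdivlMl.
exists (1 + \sum_j lam j).
  by rewrite lerDl sumr_ge0 // => j _; have [] := lamE j.
move=> z0 z z0B zP j; have [lj /(_ z0 z z0B zP)[h1 h2]] := lamE j.
have zB := polydisc_sub_uball r0 rb z0B zP.
have le : lam j <= 1 + \sum_j lam j.
  rewrite (bigD1 j) //= addrCA lerDl addr_ge0 // sumr_ge0 // => i _.
  by have [] := lamE i.
split; [apply: le_trans h1 _|apply: le_trans h2 _]; rewrite ler_wpM2r //.
  by rewrite ltW // classQ_gt0.
by rewrite ltW // classQ_gt0.
Qed.

Lemma normalized_deriv_ge0 F z K : uball z -> 0 <= normalized_deriv F L z K.
Proof.
move=> zB; rewrite divr_ge0 ?modulus_ge0 // mulr_ge0 ?ler0n //.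
by apply: prodr_ge0 => j _; rewrite exprn_ge0 // ltW // classQ_gt0.
Qed.

Lemma mi_pow_L_gt0 z K : uball z -> 0 < mi_pow (L z) K.
Proof.
by move=> zB; apply: prodr_gt0 => j _; rewrite exprn_gt0 // classQ_gt0.
Qed.

Lemma mi_fact_gt0 (K : multiindex n) : 0 < (mi_fact K)%:R :> R.
Proof. by rewrite ltr0n prodn_gt0 // => j; rewrite fact_gt0. Qed.

Lemma normalized_deriv_continuous F z K : analytic_on_uball F -> uball z ->
  {for z, continuous (fun z => normalized_deriv F L z K)}.
Proof.
move=> FA zB; apply: div_mi_pow_continuous.
- exact: modulus_mderiv_continuous.
- move=> j; have [/(_ j) + _ _] := LQ.
  rewrite continuous_open_subspace; last exact: uball_open.
  by apply; rewrite inE.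
by rewrite gt_eqF // mulr_gt0 ?mi_fact_gt0 ?mi_pow_L_gt0.
Qed.

Lemma normalized_deriv_max F rad z0 n0 : analytic_on_uball F ->
  (forall j, 0 <= rad ord0 j) -> enorm rad <= beta -> uball z0 ->
  exists M, is_maximum [set x | exists (K : multiindex n) z,
    [/\ (mi_norm K <= n0)%N, polydisc z0 (vdiv rad (L z0)) z
      & x = normalized_deriv F L z K]] M.
Proof.
move=> FA r0 rb z0B.
have /choice[zm zmP] (K : multiindex n) : exists zm,
    polydisc z0 (vdiv rad (L z0)) zm /\
    forall z, polydisc z0 (vdiv rad (L z0)) z ->
      normalized_deriv F L z K <= normalized_deriv F L zm K.
  have [||zm zmP zmM] := @polydisc_max R n z0 (vdiv rad (L z0))
      (fun z => normalized_deriv F L z K).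
  - by move=> j; apply: vdiv_ge0.
  - move=> z zP; apply: normalized_deriv_continuous => //.
    exact: polydisc_sub_uball zP.
  by exists zm.
have [K0 K0n K0max] : exists2 K0, K0 \in mi_upto n n0 &
    forall K, K \in mi_upto n n0 ->
      normalized_deriv F L (zm K) K <= normalized_deriv F L (zm K0) K0.
  apply: seq_argmax; exists (mi_zero n).
  by rewrite mem_mi_upto mi_norm0.
exists (normalized_deriv F L (zm K0) K0); split.
  by exists K0, (zm K0); rewrite -mem_mi_upto; split=> //; have [] := zmP K0.
move=> _ [K [z [Kn zP ->]]]; have [_ /(_ z zP)/le_trans] := zmP K; apply.
by apply: K0max; rewrite mem_mi_upto.
Qed.

End ClassQ.

(** * Differential inequalities *)

Section Gronwall.
Variable R : realType.

Let scaleRE (a b : R) : a *: b = a * b.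
Proof. by []. Qed.

Lemma gronwall (H dH : R -> R) (A : R) :
  (forall t : R, t \in `[0, 1] -> is_derive t 1 H (dH t)) ->
  (forall t : R, t \in `[0, 1] -> dH t <= A * H t) ->
  H 1 <= expR A * H 0.
Proof.
move=> Hd Hle.
pose G t := H t * expR (- A * t).
pose dG t := (dH t - A * H t) * expR (- A * t).
have Gd (t : R) : t \in `[0, 1] -> is_derive t 1 G (dG t).
  move=> /Hd Ht.
  have Et : is_derive t 1 (fun x => expR (- A * x)) (- A * expR (- A * t)).
    apply: is_derive_eq.
    by rewrite -[(- A)%:A]/(- A * 1) mulr1 mulrC.
  apply: is_derive_eq; rewrite !scaleRE /dG; ring.
have Goo (x : R) : x \in `]0, 1[%R -> is_derive x 1 G (dG x).
  by move=> x01; apply: Gd; apply: subset_itv_oo_cc x01.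
have Gc : {within `[0, 1], continuous G}.
  apply: derivable_within_continuous => x x01.
  by have [] := Gd x x01.
have [c c01 cE] := MVT_segment ler01 Goo Gc.
have : G 1 - G 0 <= 0.
  by rewrite cE subr0 mulr1 mulr_le0_ge0 ?expR_ge0 // subr_le0 Hle.
rewrite subr_le0 /G mulr1 mulr0 expR0 mulr1 expRN => h.
by rewrite mulrC -ler_pdivrMr ?expR_gt0.
Qed.

Lemma is_derive_of_quadratic (g : R -> R) (t d C s : R) : 0 <= C -> 0 < s ->
  (forall h, `|h| <= s -> `|g (t + h) - g t - h * d| <= C * h ^+ 2) ->
  is_derive t 1 g d.
Proof.
move=> C0 s0 H.
have gd : h^-1 *: ((g \o shift t) (h *: (1 : R^o)) - g t) @[h --> 0^'] --> (d : R^o).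
  apply: (@cvg_diffq_of_quadratic _ R^o g t 1 d C s) => // h hs.
  have := H h hs; rewrite -real_normK ?num_real //.
  by rewrite -[h *: 1]/(h * 1) mulr1 [h + t]addrC.
apply: DeriveDef; first by apply/cvg_ex; exists d.
exact: cvg_lim gd.
Qed.

(** The left-hand side is the real part of [p * q^*]. *)
Lemma Re_conj_mul_le (p q : R[i]) :
  complex.Re p * complex.Re q + complex.Im p * complex.Im q <=
  modulus p * modulus q.
Proof.
case: p q => a b [c d] /=.
have := modulus_Re ((a +i* b)%C * (c +i* (- d))%C).
rewrite Normc.normcM /= sqrrN => /(le_trans (ler_norm _)); apply: le_trans.
by rewrite mulrN opprK.
Qed.

(** Gronwall's lemma for the sum of the squared moduli, which is differentiable
    where a maximum or a sum of moduli need not be. *)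
Lemma gronwall_modulus (T : eqType) (s : seq T) (phi dphi : T -> R -> R[i]) (D : R) :
  0 <= D ->
  (forall K (t : R), t \in `[0, 1] -> exists C e : R, [/\ 0 <= C, 0 < e &
    forall h : R, `|h| <= e ->
      modulus (phi K (t + h) - phi K t - h%:C%C * dphi K t) <= C * h ^+ 2]) ->
  (forall (t : R) K, t \in `[0, 1] -> K \in s -> modulus (dphi K t) <=
     D * Num.sqrt (\sum_(J <- s) modulus (phi J t) ^+ 2)) ->
  \sum_(K <- s) modulus (phi K 1) ^+ 2 <=
    expR (2 * D * (size s)%:R) * \sum_(K <- s) modulus (phi K 0) ^+ 2.
Proof.
move=> D0 phid dle.
pose x K t := complex.Re (phi K t); pose y K t := complex.Im (phi K t).
pose dx K t := complex.Re (dphi K t); pose dy K t := complex.Im (dphi K t).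
pose H t := \sum_(K <- s) (x K t ^+ 2 + y K t ^+ 2).
have HE t : \sum_(K <- s) modulus (phi K t) ^+ 2 = H t.
  by apply: eq_bigr => K _; rewrite modulus_sqr.
rewrite !HE; pose dH t := \sum_(K <- s) (2 * x K t * dx K t + 2 * y K t * dy K t).
have Hd (t : R) : t \in `[0, 1] -> is_derive t 1 H (dH t).
  move=> t01; rewrite /H /dH; clear H HE dH dle; elim: s => [|K s' IH].
    under eq_fun do rewrite big_nil; rewrite big_nil; exact: is_derive_cst.
  under eq_fun do rewrite big_cons; rewrite big_cons.
  have [C [e [C0 e0 Ce]]] := phid K t t01.
  have xd : is_derive t 1 (x K) (dx K t).
    apply: (is_derive_of_quadratic C0 e0) => h /Ce; apply: le_trans.
    apply: le_trans (modulus_Re _); rewrite !complex_ReB /x /dx.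
    by case: (dphi K t) => a b /=; rewrite mul0r subr0.
  have yd : is_derive t 1 (y K) (dy K t).
    apply: (is_derive_of_quadratic C0 e0) => h /Ce; apply: le_trans.
    apply: le_trans (modulus_Im _); rewrite !complex_ImB /y /dy.
    by case: (dphi K t) => a b /=; rewrite mul0r addr0.
  apply: is_deriveD.
  apply: is_derive_eq; rewrite !scaleRE; ring.
apply: (@gronwall H dH) => // t t01.
set X := Num.sqrt (H t).
have X0 : 0 <= X by apply: sqrtr_ge0.
have XX : X ^+ 2 = H t.
  by rewrite sqr_sqrtr //; apply: sumr_ge0 => K _; rewrite addr_ge0 ?sqr_ge0.
have phi_le K : K \in s -> modulus (phi K t) <= X.
  move=> Ks; rewrite -(@ler_pXn2r _ 2) ?nnegrE ?modulus_ge0 // XX -HE.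
  by rewrite (big_rem K Ks) /= lerDl sumr_ge0 // => J _; rewrite sqr_ge0.
apply: le_trans (_ : \sum_(K <- s) 2 * D * X ^+ 2 <= _).
  rewrite /dH big_seq [leRHS]big_seq; apply: ler_sum => K Ks.
  rewrite -!mulrA -mulrDr ler_wpM2l //.
  apply: le_trans (Re_conj_mul_le (phi K t) (dphi K t)) _.
  rewrite expr2 mulrCA; apply: ler_pM; rewrite ?modulus_ge0 ?phi_le //.
  by have := dle t K t01 Ks; rewrite HE.
rewrite XX big_const_seq count_predT iter_addr_0 -[_ *+ _]mulr_natr mulrAC.
by [].
Qed.

End Gronwall.

(** * Growth of functions of bounded index *)

Lemma bounded_coords (R : realType) n (y : 'rV[R[i]]_n) :
  exists2 Y : R, 0 < Y & forall j, modulus (y ord0 j) <= Y.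
Proof.
exists (\sum_j modulus (y ord0 j) + 1).
  by rewrite ltr_wpDl // sumr_ge0 // => j _; apply: modulus_ge0.
move=> j; rewrite (bigD1 j) //= -addrA lerDl addr_ge0 // sumr_ge0 // => i _.
exact: modulus_ge0.
Qed.

Lemma ler_mi_pow (R : realType) n (a b : 'rV[R]_n) (x : R) (K : multiindex n) :
  (forall j, 0 <= a ord0 j) -> (forall j, a ord0 j <= x * b ord0 j) ->
  mi_pow a K <= x ^+ mi_norm K * mi_pow b K.
Proof.
move=> a0 ab; rewrite -mi_powZ; apply: ler_prod => j _.
by rewrite exprn_ge0 //= lerXn2r ?nnegrE ?(le_trans (a0 j)) // mxE.
Qed.

Lemma mi_factS n (K : multiindex n) j :
  mi_fact (madd K (munit j)) = ((K j).+1 * mi_fact K)%N.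
Proof.
rewrite /mi_fact (bigD1 j) // [in RHS](bigD1 j) //= !ffunE eqxx addn1 factS mulnA.
by congr (_ * _)%N; apply: eq_bigr => i /negbTE ij; rewrite !ffunE ij addn0.
Qed.

Lemma sqrt_sum_sqr_le (R : realType) (T : Type) (s : seq T) (g : T -> R) :
  (forall x, 0 <= g x) -> Num.sqrt (\sum_(x <- s) g x ^+ 2) <= \sum_(x <- s) g x.
Proof.
move=> g0; have S0 (s' : seq T) : 0 <= \sum_(x <- s') g x by apply: sumr_ge0.
rewrite -[leRHS]ger0_norm // -sqrtr_sqr ler_wsqrtr //.
elim: s => [|x s IH]; first by rewrite !big_nil expr0n.
rewrite !big_cons sqrrD addrAC -addrA lerD2l; apply: le_trans IH _.
by rewrite lerDl mulrn_wge0 // mulr_ge0.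
Qed.

Section Growth.
Variables (R : realType) (n : nat) (beta : R) (L : 'rV[R[i]]_n -> 'rV[R]_n).
Hypotheses (beta0 : 0 < beta) (LQ : classQ beta L).
Variable F : 'rV[R[i]]_n -> R[i].
Hypothesis FA : analytic_on_uball F.
Variable m : nat.
Hypothesis Fm : forall (z : 'rV[R[i]]_n) (J : multiindex n), uball z ->
  normalized_deriv F L z J <=
  \big[Num.max/0]_(K : {ffun 'I_n -> 'I_m.+1} | (mi_norm (mi_of K) <= m)%N)
      normalized_deriv F L z (mi_of K).
Variable rad : 'rV[R]_n.
Hypotheses (rad0 : forall j, 0 <= rad ord0 j) (radb : enorm rad <= beta).

Lemma normalized_deriv_le_of_head z J x : uball z -> 0 <= x ->
  (forall K, K \in mi_upto n m -> normalized_deriv F L z K <= x) ->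
  normalized_deriv F L z J <= x.
Proof.
move=> zB x0 H; apply: le_trans (Fm J zB) _; apply: bigmax_le => // K Km.
by apply: H; rewrite mem_mi_upto.
Qed.

Variable Lam : R.
Hypothesis Lam1 : 1 <= Lam.
Hypothesis LamP : forall z0 z, uball z0 -> polydisc z0 (vdiv rad (L z0)) z ->
    forall j, L z ord0 j <= Lam * L z0 ord0 j /\ L z0 ord0 j <= Lam * L z ord0 j.

Let Lam0 : 0 <= Lam. Proof. exact: le_trans Lam1. Qed.

(** Along the segment from [z0] the normalizing weights are kept equal to those
    of [z0], so that they are not differentiated. *)
Definition frozen_deriv z0 z K :=
  modulus (mderiv K F z) / ((mi_fact K)%:R * mi_pow (L z0) K).

Lemma frozen_deriv_ge0 z0 z K : uball z0 -> 0 <= frozen_deriv z0 z K.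
Proof.
move=> z0B; rewrite divr_ge0 ?modulus_ge0 // mulr_ge0 ?ler0n //.
by rewrite ltW // (mi_pow_L_gt0 beta0 LQ).
Qed.

Lemma frozen_deriv_ratio y z w K : uball y -> uball w ->
  (forall j, L y ord0 j <= Lam * L w ord0 j) ->
  frozen_deriv w z K <= Lam ^+ mi_norm K * frozen_deriv y z K.
Proof.
move=> yB wB h; rewrite /frozen_deriv mulrCA ler_wpM2l ?modulus_ge0 //.
have py := mi_pow_L_gt0 beta0 LQ K yB; have pw := mi_pow_L_gt0 beta0 LQ K wB.
have fK := mi_fact_gt0 R K.
rewrite !invfM mulrCA ler_wpM2l ?invr_ge0 ?(ltW fK) //.
rewrite ler_pdivlMr // mulrC ler_pdivrMr //.
by apply: ler_mi_pow h => j; rewrite ltW // (classQ_gt0 beta0 LQ).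
Qed.

(** Differentiating along the segment gives frozen derivatives of order at most
    [m.+1].  Passing from these to the normalization at the moving point costs a
    factor [Lam ^+ m.+1]; there the index applies; returning to the weights of
    [z0] costs [Lam ^+ m]. *)
Lemma normalized_deriv_growth z0 z K : uball z0 -> polydisc z0 (vdiv rad (L z0)) z ->
  K \in mi_upto n m ->
  normalized_deriv F L z K <=
    Lam ^+ m * Num.sqrt (expR (2 * (n%:R * (beta * m.+1%:R * Lam ^+ (m + m.+1))) *
      (size (mi_upto n m))%:R)) * \sum_(J <- mi_upto n m) normalized_deriv F L z0 J.
Proof.
move=> z0B zP Km.
set D := n%:R * _; have D0 : 0 <= D.
  by rewrite !mulr_ge0 ?ler0n ?exprn_ge0 ?(ltW beta0).
pose v := z - z0.
pose path (t : R) := z0 + t%:C%C *: v.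
have path0 : path 0 = z0 by rewrite /path scale0r addr0.
have path1 : path 1 = z by rewrite /path scale1r addrC subrK.
have pathP t : t \in `[0, 1] -> polydisc z0 (vdiv rad (L z0)) (path t).
  rewrite in_itv /= => /andP[t0 t1] j.
  have -> : path t ord0 j - z0 ord0 j = t%:C%C * (z ord0 j - z0 ord0 j).
    by rewrite !mxE addrC addKr.
  rewrite Normc.normcM modulus_real ger0_norm //; apply: le_trans (zP j).
  by rewrite ler_piMl ?modulus_ge0.
have pathB t (t01 : t \in `[0, 1]) :=
  polydisc_sub_uball beta0 LQ rad0 radb z0B (pathP t t01).
have zB : uball z by rewrite -path1; apply: pathB; rewrite in_itv /= ler01 lexx.
(* The quantities to which Gronwall's lemma is applied: weighted derivatives of
   [F] on the segment, and their derivatives in [t]. *)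
pose wt K := ((mi_fact K)%:R * mi_pow (L z0) K)^-1.
have wt0 J : 0 < wt J.
  by rewrite invr_gt0 mulr_gt0 ?mi_fact_gt0 ?(mi_pow_L_gt0 beta0 LQ).
pose phi K t := (wt K)%:C%C * mderiv K F (path t).
pose dphi K t := (wt K)%:C%C *
  \sum_(j < n) v ord0 j * mderiv (madd K (munit j)) F (path t).
have phiE J t : modulus (phi J t) = frozen_deriv z0 (path t) J.
  by rewrite Normc.normcM modulus_real gtr0_norm // mulrC.
have sumsq_le t J : J \in mi_upto n m -> frozen_deriv z0 (path t) J <=
    Num.sqrt (\sum_(J <- mi_upto n m) modulus (phi J t) ^+ 2).
  move=> Jm; rewrite -phiE -[leLHS]ger0_norm ?modulus_ge0 // -sqrtr_sqr.
  rewrite ler_wsqrtr // (big_rem J Jm) /= lerDl sumr_ge0 // => J' _.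
  exact: sqr_ge0.
have G : \sum_(J <- mi_upto n m) modulus (phi J 1) ^+ 2 <=
    expR (2 * D * (size (mi_upto n m))%:R) *
      \sum_(J <- mi_upto n m) modulus (phi J 0) ^+ 2.
  apply: (@gronwall_modulus R _ (mi_upto n m) phi dphi D D0).
  - move=> J t t01; have [C [s [C0 s0 H]]] := mderiv_differential J FA (pathB t t01).
    have [V V0 vV] := bounded_coords v.
    exists (wt J * (C * V ^+ 2)), (s / V); split.
    + by rewrite !mulr_ge0 ?exprn_ge0 // ltW.
    + by rewrite divr_gt0.
    move=> h hs.
    have pE : path (t + h) = path t + h%:C%C *: v.
      by rewrite /path rmorphD scalerDl addrA.
    have -> : phi J (t + h) - phi J t - h%:C%C * dphi J t = (wt J)%:C%C *
        (mderiv J F (path t + h%:C%C *: v) - mderiv J F (path t) -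
         \sum_(j < n) (h%:C%C *: v) ord0 j * mderiv (madd J (munit j)) F (path t)).
      have -> : \sum_(j < n) (h%:C%C *: v) ord0 j *
          mderiv (madd J (munit j)) F (path t) =
          h%:C%C * \sum_(j < n) v ord0 j * mderiv (madd J (munit j)) F (path t).
        by rewrite mulr_sumr; apply: eq_bigr => j _; rewrite mxE mulrA.
      by rewrite /phi /dphi pE; ring.
    rewrite Normc.normcM modulus_real gtr0_norm // -mulrA ler_wpM2l ?(ltW (wt0 J)) //.
    rewrite -mulrA -[h ^+ 2]real_normK ?num_real // -exprMn [V * _]mulrC.
    apply: H; first by rewrite mulr_ge0 // ltW.
      by rewrite -ler_pdivlMr.
    by move=> j; rewrite mxE Normc.normcM modulus_real ler_wpM2l.
  - move=> t J t01 Jm; set X := Num.sqrt _.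
    have X0 : 0 <= X by apply: sqrtr_ge0.
    have tB := pathB t t01.
    have all_le J' : normalized_deriv F L (path t) J' <= Lam ^+ m * X.
      apply: normalized_deriv_le_of_head => //; first by rewrite mulr_ge0 ?exprn_ge0.
      move=> I Im; apply: le_trans (_ : Lam ^+ m * frozen_deriv z0 (path t) I <= _).
        apply: (le_trans (@frozen_deriv_ratio z0 (path t) (path t) I z0B tB _)).
          by move=> j; have [] := LamP z0B (pathP t t01) j.
        rewrite ler_wpM2r ?frozen_deriv_ge0 // ler_weXn2l //.
        by rewrite -mem_mi_upto.
      by rewrite ler_wpM2l ?exprn_ge0 // sumsq_le.
    rewrite /dphi mulr_sumr; apply: le_trans (modulus_sum _ _ _) _.
    rewrite /D -!mulrA mulr_natl -[X in _ *+ X](card_ord n) -sumr_const.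
    apply: ler_sum => j _.
    rewrite !Normc.normcM modulus_real gtr0_norm //.
    have -> : wt J *
        (modulus (v ord0 j) * modulus (mderiv (madd J (munit j)) F (path t))) =
      modulus (v ord0 j) * L z0 ord0 j *
        ((J j).+1%:R * frozen_deriv z0 (path t) (madd J (munit j))).
      rewrite /frozen_deriv mi_factS mi_powD mi_pow_unit natrM /wt.
      have L0 : L z0 ord0 j != 0 by rewrite gt_eqF // (classQ_gt0 beta0 LQ).
      have p0 : mi_pow (L z0) J != 0 by rewrite gt_eqF // (mi_pow_L_gt0 beta0 LQ).
      have f0 : (mi_fact J)%:R != 0 :> R by rewrite gt_eqF // mi_fact_gt0.
      by field; rewrite L0 p0 f0 nat1r pnatr_eq0.
    have -> : beta * (m.+1%:R * (Lam ^+ (m + m.+1) * X)) =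
      beta * (m.+1%:R * (Lam ^+ m.+1 * (Lam ^+ m * X))).
      by rewrite [Lam ^+ (m + _)]exprD; ring.
    apply: ler_pM.
    - by rewrite mulr_ge0 ?modulus_ge0 // ltW // (classQ_gt0 beta0 LQ).
    - by rewrite mulr_ge0 ?ler0n ?frozen_deriv_ge0.
    - apply: le_trans radb; apply: le_trans (_ : rad ord0 j <= _).
        have := zP j; rewrite !mxE ler_pdivlMr //.
        by rewrite (classQ_gt0 beta0 LQ).
      rewrite -[leLHS]ger0_norm ?rad0 // -sqrtr_sqr ler_wsqrtr //.
      by rewrite (bigD1 j) //= lerDl sumr_ge0 // => i _; rewrite sqr_ge0.
    apply: ler_pM; rewrite ?ler0n ?frozen_deriv_ge0 //.
      by rewrite ler_nat ltnS (leq_trans (mi_le_norm J j)) // -mem_mi_upto.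
    apply: (le_trans (@frozen_deriv_ratio (path t) (path t) z0 _ tB z0B _)).
      by move=> i; have [] := LamP z0B (pathP t t01) i.
    apply: ler_pM; rewrite ?exprn_ge0 ?frozen_deriv_ge0 ?all_le //.
    by rewrite ler_weXn2l // mi_normD mi_norm_unit addn1 ltnS -mem_mi_upto.
apply: (le_trans (@frozen_deriv_ratio z0 z z K z0B zB _)).
  by move=> j; have [] := LamP z0B zP j.
rewrite -mulrA; apply: ler_pM; rewrite ?exprn_ge0 ?frozen_deriv_ge0 //.
  by rewrite ler_weXn2l // -mem_mi_upto.
rewrite -path1; apply: le_trans (sumsq_le 1 K Km) _.
apply: le_trans (ler_wsqrtr G) _; rewrite sqrtrM ?expR_ge0 //.
rewrite ler_wpM2l ?sqrtr_ge0 //.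
have -> : \sum_(J <- mi_upto n m) normalized_deriv F L z0 J =
    \sum_(J <- mi_upto n m) modulus (phi J 0).
  by apply: eq_bigr => J _; rewrite phiE path0.
by apply: sqrt_sum_sqr_le => J; apply: modulus_ge0.
Qed.

End Growth.

(** * A maximum principle *)

Section Peano.
Variable R : realType.
Implicit Types (h f g : R[i] -> R[i]) (w z : R[i]).

(** Such expansions suffice for the maximum principle below, and multiplying two
    of them takes no rearrangement of series. *)
Definition peano2 h w : Prop :=
  exists b1 b2 C s, [/\ 0 <= C, 0 < s & forall x, modulus x <= s ->
    modulus (h (w + x) - h w - b1 * x - b2 * x ^+ 2) <= C * modulus x ^+ 3].

Lemma peano2_ext f g w : (exists2 s, 0 < s & forall x, modulus x <= s ->
  f (w + x) = g (w + x)) -> peano2 f w -> peano2 g w.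
Proof.
move=> [s s0 fg] [b1 [b2 [C [e [C0 e0 H]]]]].
exists b1, b2, C, (Num.min s e); split => //; first by rewrite lt_min s0.
move=> x; rewrite le_min => /andP[xs xe].
have := H x xe; rewrite fg // -[in f w](addr0 w) fg ?addr0 //.
by rewrite Normc.normc0 ltW.
Qed.

Lemma peano2_cst (k : R[i]) w : peano2 (fun=> k) w.
Proof.
exists 0, 0, 0, 1; split=> // x _.
by rewrite !mul0r subrr !subr0 Normc.normc0.
Qed.

Lemma peano2_id w : peano2 id w.
Proof.
exists 1, 0, 0, 1; split=> // x _.
have -> : id (w + x) - id w - 1 * x - 0 * x ^+ 2 = 0 by rewrite /=; ring.
by rewrite Normc.normc0 mul0r.
Qed.

Lemma peano2D f g w : peano2 f w -> peano2 g w -> peano2 (fun z => f z + g z) w.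
Proof.
move=> [b1 [b2 [C [s [C0 s0 H]]]]] [d1 [d2 [D [e [D0 e0 I]]]]].
exists (b1 + d1), (b2 + d2), (C + D), (Num.min s e).
split; rewrite ?addr_ge0 ?lt_min ?s0 // => x.
rewrite le_min => /andP[xs xe].
have -> : f (w + x) + g (w + x) - (f w + g w) - (b1 + d1) * x - (b2 + d2) * x ^+ 2 =
  (f (w + x) - f w - b1 * x - b2 * x ^+ 2) + (g (w + x) - g w - d1 * x - d2 * x ^+ 2) by ring.
by rewrite mulrDl; apply: le_trans (modulusD _ _) (lerD (H _ xs) (I _ xe)).
Qed.

Lemma peano2M f g w : peano2 f w -> peano2 g w -> peano2 (fun z => f z * g z) w.
Proof.
move=> [b1 [b2 [C [s [C0 s0 H]]]]] [d1 [d2 [D [e [D0 e0 I]]]]].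
pose E := C * (modulus (g w) + modulus d1 + modulus d2 + D) +
  (modulus (f w) + modulus b1 + modulus b2) * D +
  (modulus (b1 * d2 + b2 * d1) + modulus (b2 * d2)).
exists (f w * d1 + b1 * g w), (f w * d2 + b1 * d1 + b2 * g w), E, (Num.min 1 (Num.min s e)).
split.
- by rewrite /E !addr_ge0 ?mulr_ge0 ?addr_ge0 ?modulus_ge0.
- by rewrite !lt_min ltr01 s0.
move=> x; rewrite !le_min => /and3P[x1 xs xe].
have := H x xs; have := I x xe.
set p := f (w + x) - _ - _ - _; set q := g (w + x) - _ - _ - _ => qb pb.
have -> : f (w + x) * g (w + x) - f w * g w - (f w * d1 + b1 * g w) * x -
    (f w * d2 + b1 * d1 + b2 * g w) * x ^+ 2 =
    p * (g w + d1 * x + d2 * x ^+ 2 + q) + (f w + b1 * x + b2 * x ^+ 2) * q +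
    ((b1 * d2 + b2 * d1) + b2 * d2 * x) * x ^+ 3 by rewrite /p /q; ring.
set X := modulus x; have X0 : 0 <= X by apply: modulus_ge0.
have X3 : 0 <= X ^+ 3 by rewrite exprn_ge0.
have small (u : R[i]) k : modulus (u * x ^+ k) <= modulus u.
  by rewrite Normc.normcM modulusX ler_piMr ?modulus_ge0 // exprn_ile1.
have small1 (u : R[i]) : modulus (u * x) <= modulus u.
  by have := small u 1; rewrite expr1.
rewrite /E !(mulrDl _ _ (X ^+ 3)).
apply: le_trans (modulusD _ _) (lerD _ _); last first.
  rewrite Normc.normcM modulusX -mulrDl ler_wpM2r //.
  exact: le_trans (modulusD _ _) (lerD (lexx _) (small1 _)).
apply: le_trans (modulusD _ _) (lerD _ _).
  rewrite Normc.normcM mulrAC; apply: ler_pM; rewrite ?modulus_ge0 //.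
  apply: le_trans (modulusD _ _) (lerD _ _); last first.
    by apply: le_trans qb _; rewrite ler_piMr // exprn_ile1.
  apply: le_trans (modulusD _ _) (lerD _ (small _ _)).
  exact: le_trans (modulusD _ _) (lerD (lexx _) (small1 _)).
rewrite Normc.normcM -mulrA; apply: ler_pM; rewrite ?modulus_ge0 //.
apply: le_trans (modulusD _ _) (lerD _ (small _ _)).
exact: le_trans (modulusD _ _) (lerD (lexx _) (small1 _)).
Qed.

Lemma peano2_inv w : w != 0 -> peano2 (fun z => z^-1) w.
Proof.
move=> w0; have W0 : 0 < modulus w by rewrite modulus_gt0.
exists (- w ^- 2), (w ^- 3), (2 / modulus w ^+ 4), (modulus w / 2).
split; rewrite ?divr_ge0 ?exprn_ge0 ?modulus_ge0 ?divr_gt0 // => x xw.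
have wx : modulus w / 2 <= modulus (w + x).
  have := modulusD (w + x) (- x); rewrite addrK modulusN; lra.
have wx0 : w + x != 0.
  by rewrite -modulus_gt0; apply: lt_le_trans wx; rewrite divr_gt0.
have -> : (w + x)^-1 - w^-1 - - w ^- 2 * x - w ^- 3 * x ^+ 2 =
    - (w ^- 3 * (w + x)^-1) * x ^+ 3 by field; rewrite w0 wx0.
rewrite Normc.normcM modulusN modulusX ler_wpM2r ?exprn_ge0 ?modulus_ge0 //.
rewrite Normc.normcM !Normc.normcV modulusX.
have -> : 2 / modulus w ^+ 4 = (modulus w ^+ 3)^-1 * (modulus w / 2)^-1.
  by field; rewrite gt_eqF.
rewrite ler_wpM2l ?invr_ge0 ?exprn_ge0 ?modulus_ge0 //.
by rewrite lef_pV2 // posrE ?modulus_gt0 // divr_gt0.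
Qed.

Lemma peano2_div_expr f w k : w != 0 -> peano2 f w -> peano2 (fun z => f z / z ^+ k) w.
Proof.
move=> w0 fw; elim: k => [|k IH].
  by apply: peano2_ext fw; exists 1 => // x _; rewrite expr0 divr1.
apply: peano2_ext (peano2M IH (peano2_inv w0)).
by exists 1 => // x _; rewrite exprSr invfM mulrA.
Qed.

Lemma peano2_sum (T : Type) (s : seq T) (f : T -> R[i] -> R[i]) w :
  (forall i, peano2 (f i) w) -> peano2 (fun z => \sum_(i <- s) f i z) w.
Proof.
move=> fw; elim: s => [|i s IH].
  under eq_fun do rewrite big_nil; exact: peano2_cst.
under eq_fun do rewrite big_cons; exact: peano2D.
Qed.

Lemma peano2_continuous f w : peano2 f w ->
  {for w, continuous (fun z => modulus (f z))}.
Proof.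
move=> [b1 [b2 [C [s [C0 s0 H]]]]].
apply/(@cvgrPdist_lt _ _ _ (nbhs w) (nbhs_filter w)) => e e0.
set D := modulus b1 + modulus b2 + C + 1.
have D0 : 0 < D by rewrite ltr_wpDl // !addr_ge0 ?modulus_ge0.
set d := Num.min 1 (Num.min s (e / D)).
have d0 : 0 < d by rewrite !lt_min ltr01 s0 divr_gt0.
apply/nbhs_ballP; exists d%:C%C; first by rewrite /= ltcR.
move=> y; rewrite -ball_normE /= normCE ltcR modulusB.
rewrite !lt_min => /and3P[y1 ys ye].
apply: le_lt_trans (modulus_dist _ _) _; rewrite modulusB.
set x := y - w in y1 ys ye; have -> : y = w + x by rewrite addrC subrK.
have -> : f (w + x) - f w = (f (w + x) - f w - b1 * x - b2 * x ^+ 2) +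
  (b1 * x + b2 * x ^+ 2) by ring.
set X := modulus x in y1 ys ye.
have X0 : 0 <= X by apply: modulus_ge0.
apply: (@le_lt_trans _ _ ((C + (modulus b1 + modulus b2)) * X)).
  rewrite mulrDl; apply: le_trans (modulusD _ _) (lerD _ _).
    apply: le_trans (H _ (ltW ys)) _; rewrite ler_wpM2l // -/X exprSr.
    by rewrite ler_piMl // exprn_ile1 // ltW.
  rewrite mulrDl; apply: le_trans (modulusD _ _) (lerD _ _).
    by rewrite Normc.normcM.
  rewrite Normc.normcM modulusX ler_wpM2l ?modulus_ge0 // -/X exprSr.
  by rewrite ler_piMl // ltW.
move: ye; rewrite ltr_pdivlMr // mulrC; apply: le_lt_trans.
by rewrite ler_wpM2r // /D; lra.
Qed.

(** Averaging over the four points [w +- s], [w +- 'i s] kills the terms of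
    orders one and two, so [|h|] is subharmonic up to order three, which the
    strictly subharmonic [eps * |z| ^ 2] beats. *)
Lemma peano2_max_modulus h M : (forall w, modulus w <= 1 -> peano2 h w) ->
  (forall w, modulus w = 1 -> modulus (h w) <= M) -> modulus (h 0) <= M.
Proof.
move=> hP hM; apply/ler_addgt0Pr => e e0.
pose u z := modulus (h z) + e * modulus z ^+ 2.
have uc z : modulus z <= 1 -> {for z, continuous u}.
  have cont (T : topologicalType) (y : T) (f g : T -> R) :
      {for y, continuous f} -> {for y, continuous g} ->
      {for y, continuous (fun x => f x + e * g x ^+ 2)}.
    move=> fc gc; apply: cvgD => //.
    by apply: cvgM; [exact: cvg_cst|apply: cvgM].
  move=> z1; apply: cont; first exact: peano2_continuous (hP z z1).
  exact: peano2_continuous (peano2_id z).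
have [|||w] := @compact_EVT_max _ _ u [set z | modulus (z - 0) <= 1].
- by exists (0 : R[i]); rewrite /mkset subr0 Normc.normc0.
- exact: closed_disc_compact.
- by apply: continuous_in_subspaceT => z; rewrite inE /= subr0 => /uc.
rewrite inE /= subr0 => w1 wmax.
have {}wmax z : modulus z <= 1 -> u z <= u w.
  by move=> z1; apply: wmax; rewrite inE /= subr0.
have u0 : modulus (h 0) <= u 0.
  by rewrite /u lerDl mulr_ge0 ?exprn_ge0 ?modulus_ge0 // ltW.
move: w1; rewrite le_eqVlt => /orP[/eqP w1|w1].
  apply: le_trans u0 _; apply: le_trans (wmax 0 _) _; first by rewrite Normc.normc0.
  by rewrite /u w1 expr1n mulr1 lerD2r hM.
exfalso; have [b1 [b2 [C [s [C0 s0 H]]]]] := hP w (ltW w1).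
set d := Num.min s (Num.min (1 - modulus w) (e / (C + 1))).
have C1 : 0 < C + 1 by rewrite ltr_wpDl.
have d0 : 0 < d by rewrite !lt_min s0 subr_gt0 w1 divr_gt0.
have : d <= d by [].
rewrite {2}/d !le_min => /and3P[ds dw de].
(* The first and second powers of these four increments have sum zero, while
   their squared moduli add up. *)
have [x1 [x2 [x3 [x4 [xm1 xm2 xm3 xm4]]]]] :
  exists x1 x2 x3 x4 : R[i], [/\ x1 = d%:C%C, x2 = - d%:C%C, x3 = (0 +i* d)%C &
     x4 = - (0 +i* d)%C] by do 4!eexists; split.
have m1 : modulus x1 = d by rewrite xm1 modulus_real gtr0_norm.
have m2 : modulus x2 = d by rewrite xm2 modulusN modulus_real gtr0_norm.
have m3 : modulus x3 = d by rewrite xm3 /= expr0n add0r sqrtr_sqr gtr0_norm.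
have m4 : modulus x4 = d.
  by rewrite xm4 modulusN /= expr0n add0r sqrtr_sqr gtr0_norm.
have ux x : modulus x = d -> modulus (h (w + x)) + e * modulus (w + x) ^+ 2 <= u w.
  move=> xd; apply: wmax; apply: le_trans (modulusD _ _) _; rewrite xd.
  by rewrite -lerBrDl.
have Hx x : modulus x = d ->
  modulus (h (w + x) - h w - b1 * x - b2 * x ^+ 2) <= C * d ^+ 3.
  by move=> xd; have := H x; rewrite xd; apply.
have sq : modulus (w + x1) ^+ 2 + modulus (w + x2) ^+ 2 + modulus (w + x3) ^+ 2 +
   modulus (w + x4) ^+ 2 = 4 * modulus w ^+ 2 + 4 * d ^+ 2.
  rewrite !modulus_sqr xm1 xm2 xm3 xm4; case: (w) => a b /=; ring.
have mean : 4 * modulus (h w) <= modulus (h (w + x1)) + modulus (h (w + x2)) +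
    modulus (h (w + x3)) + modulus (h (w + x4)) + 4 * (C * d ^+ 3).
  have -> : 4 * modulus (h w) = modulus (4 * h w).
    by rewrite Normc.normcM modulus_nat.
  have -> : 4 * h w = h (w + x1) + h (w + x2) + h (w + x3) + h (w + x4) -
     ((h (w + x1) - h w - b1 * x1 - b2 * x1 ^+ 2) +
      (h (w + x2) - h w - b1 * x2 - b2 * x2 ^+ 2) +
      (h (w + x3) - h w - b1 * x3 - b2 * x3 ^+ 2) +
      (h (w + x4) - h w - b1 * x4 - b2 * x4 ^+ 2)).
    have sum1 : x1 + x2 + x3 + x4 = 0 by rewrite xm1 xm2 xm3 xm4; ring.
    have sum2 : x1 ^+ 2 + x2 ^+ 2 + x3 ^+ 2 + x4 ^+ 2 = 0.
      rewrite xm1 xm2 xm3 xm4; apply/eqP; rewrite !expr2 eq_complex /=.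
      by apply/andP; split; apply/eqP; ring.
    apply/eqP; rewrite -subr_eq0; apply/eqP.
    transitivity (- (b1 * (x1 + x2 + x3 + x4) +
        b2 * (x1 ^+ 2 + x2 ^+ 2 + x3 ^+ 2 + x4 ^+ 2))); first by ring.
    by rewrite sum1 sum2 !mulr0 addr0 oppr0.
  apply: le_trans (modulusD _ _) _; rewrite modulusN; apply: lerD.
    apply: le_trans (modulusD _ _) (lerD _ (lexx _)).
    apply: le_trans (modulusD _ _) (lerD _ (lexx _)).
    exact: modulusD.
  have -> : 4 * (C * d ^+ 3) = C * d ^+ 3 + C * d ^+ 3 + C * d ^+ 3 + C * d ^+ 3 by ring.
  apply: le_trans (modulusD _ _) (lerD _ (Hx _ m4)).
  apply: le_trans (modulusD _ _) (lerD _ (Hx _ m3)).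
  exact: le_trans (modulusD _ _) (lerD (Hx _ m1) (Hx _ m2)).
have u1 := ux _ m1; have u2 := ux _ m2; have u3 := ux _ m3; have u4 := ux _ m4.
have usum : modulus (h (w + x1)) + modulus (h (w + x2)) + modulus (h (w + x3)) +
    modulus (h (w + x4)) + e * (4 * modulus w ^+ 2 + 4 * d ^+ 2) <=
    4 * (modulus (h w) + e * modulus w ^+ 2).
  by rewrite -sq -/(u w); lra.
have ed : e * d ^+ 2 <= C * d ^+ 3 by lra.
have : d ^+ 2 * (d * (C + 1)) <= d ^+ 2 * e.
  by rewrite ler_wpM2l ?exprn_ge0 ?(ltW d0) // -ler_pdivlMr.
have d3 : 0 < d ^+ 3 by rewrite exprn_gt0.
have -> : d ^+ 2 * (d * (C + 1)) = C * d ^+ 3 + d ^+ 3 by ring.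
lra.
Qed.

End Peano.

(** * Cauchy's inequality *)

Lemma primitive_root_exists (C : numClosedFieldType) N : (0 < N)%N ->
  exists z : C, N.-primitive_root z.
Proof.
move=> N0; have [rs rsP] := closed_field_poly_normal ('X^N - 1 : {poly C}).
rewrite (monicP _) ?monicXnsubC // scale1r in rsP.
have /hasP[z _ zP] : has N.-primitive_root rs; last by exists z.
apply: has_prim_root => //.
- by apply/allP => z; rewrite -root_prod_XsubC -rsP.
- by rewrite -separable_prod_XsubC -rsP cyclotomic.separable_Xn_sub_1 // pnatr_eq0 -lt0n.
by rewrite -ltnS -(size_prod_XsubC rs id) -rsP size_XnsubC.
Qed.

Section Cauchy.
Variable R : realType.

(** The maximum principle for [phi t / t ^+ k], extended by [A] at [0].  The
    error [t ^ k.+3] is what makes the extension have a second-order expansion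
    at [0]. *)
Lemma coef_le_of_peano2 (phi : R[i] -> R[i]) (A : R[i]) (k : nat) (M C s : R) :
  0 <= C -> 0 < s ->
  (forall t, modulus t <= s -> modulus (phi t - A * t ^+ k) <= C * modulus t ^+ k.+3) ->
  (forall t, modulus t <= 1 -> peano2 phi t) ->
  (forall t, modulus t = 1 -> modulus (phi t) <= M) ->
  modulus A <= M.
Proof.
move=> C0 s0 phi0 phiP phiM.
pose h t := if t == 0 then A else phi t / t ^+ k.
have -> : A = h 0 by rewrite /h eqxx.
apply: peano2_max_modulus => [w w1|w w1]; last first.
  rewrite /h; case: eqP => [w0|_].
    by move: w1; rewrite w0 Normc.normc0 => /eqP; rewrite eq_sym oner_eq0.
  by rewrite Normc.normcM Normc.normcV modulusX w1 expr1n invr1 mulr1 phiM.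
have [->|w0] := eqVneq w 0.
  exists 0, 0, C, s; split=> // x xs; rewrite add0r !mul0r !subr0 /h eqxx.
  case: eqP => [->|/eqP x0].
    by rewrite subrr Normc.normc0 expr0n mulr0.
  have xk : 0 < modulus x ^+ k by rewrite exprn_gt0 // modulus_gt0.
  have -> : phi x / x ^+ k - A = (phi x - A * x ^+ k) / x ^+ k.
    by rewrite mulrBl mulfK // expf_neq0.
  rewrite Normc.normcM Normc.normcV modulusX ler_pdivrMr // -mulrA -exprD.
  by rewrite add3n phi0.
apply: peano2_ext (peano2_div_expr k w0 (phiP w w1)).
exists (modulus w / 2); first by rewrite divr_gt0 // modulus_gt0.
move=> x xw; rewrite /h; case: eqP => // wx0; exfalso.
have := modulusD (w + x) (- x); rewrite addrK modulusN wx0 Normc.normc0 add0r.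
have : 0 < modulus w by rewrite modulus_gt0.
lra.
Qed.

Definition approx0 q (f P : R[i] -> R[i]) : Prop :=
  exists C s, [/\ 0 <= C, 0 < s & forall t, modulus t <= s ->
    modulus (f t - P t) <= C * modulus t ^+ q].

Lemma approx0_lincomb q (T : Type) (e : seq T) (a : T -> R[i])
    (f P : T -> R[i] -> R[i]) : (forall i, approx0 q (f i) (P i)) ->
  approx0 q (fun t => \sum_(i <- e) a i * f i t) (fun t => \sum_(i <- e) a i * P i t).
Proof.
move=> fP; elim: e => [|i e [C [s [C0 s0 H]]]].
  exists 0, 1; split=> // t _.
  by rewrite !big_nil subrr Normc.normc0 mul0r.
have [D [d [D0 d0 I]]] := fP i.
exists (modulus (a i) * D + C), (Num.min d s).
split; rewrite ?addr_ge0 ?mulr_ge0 ?modulus_ge0 ?lt_min ?d0 // => t.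
rewrite le_min => /andP[td ts]; rewrite !big_cons opprD addrACA -mulrBr mulrDl.
apply: le_trans (modulusD _ _) (lerD _ (H t ts)).
by rewrite Normc.normcM -mulrA ler_wpM2l ?modulus_ge0 // I.
Qed.

Variable n : nat.
Implicit Types (F : 'rV[R[i]]_n -> R[i]) (z y a : 'rV[R[i]]_n).
Implicit Types (c : multiindex n -> R[i]).

Lemma approx0_line F a r c q y : expands F a r c ->
  approx0 q.+1 (fun t => F (a + t *: y))
    (fun t => \sum_(K <- mi_upto n q) c K * mi_pow y K * t ^+ mi_norm K).
Proof.
move=> Fc; have [C [s [C0 s0 H]]] := expands_taylor q Fc.
have [Y Y0 yY] := bounded_coords y.
exists (C * Y ^+ q.+1), (s / Y); split.
- by rewrite mulr_ge0 ?exprn_ge0 // ltW.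
- by rewrite divr_gt0.
move=> t ts; rewrite -mulrA -exprMn mulrC.
have -> : \sum_(K <- mi_upto n q) c K * mi_pow y K * t ^+ mi_norm K =
    \sum_(K <- mi_upto n q) c K * mi_pow (t *: y) K.
  by apply: eq_bigr => K _; rewrite mi_powZ mulrAC mulrA.
rewrite mulrC [Y * _]mulrC; apply: H.
- by rewrite mulr_ge0 ?modulus_ge0 // ltW.
- by rewrite -ler_pdivlMr.
by move=> j; rewrite mxE Normc.normcM ler_wpM2l ?modulus_ge0.
Qed.

Lemma peano2_line F z0 y w : analytic_on_uball F -> uball (z0 + w *: y) ->
  peano2 (fun t => F (z0 + t *: y)) w.
Proof.
move=> FA wB; have [c [r Fc]] := analytic_expands FA wB.
have [C [s [C0 s0 H]]] := approx0_line 2 y Fc.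
pose b k := \sum_(K <- mi_upto n k | mi_norm K == k) c K * mi_pow y K.
exists (b 1%N), (b 2%N), C, s; split=> // x xs.
have := H x xs; rewrite sum_mi_upto_degree !big_ord_recl big_ord0 /= addr0.
have bE k : \sum_(K <- mi_upto n k | mi_norm K == k) c K * mi_pow y K * x ^+ mi_norm K =
    b k * x ^+ k.
  by rewrite /b mulr_suml; apply: eq_bigr => K /eqP ->.
rewrite !bE /bump /= !add1n expr1.
have -> : b 0%N * x ^+ 0 = F (z0 + w *: y).
  by rewrite /b mi_upto0 big_mkcond big_seq1 mi_norm0 eqxx mi_pow0 !mulr1 (expands_center Fc).
by rewrite scalerDl addrA !opprD !addrA.
Qed.

(** The average over the torus of the [N]-th roots of unity, twisted by the
    character [K], isolates the coefficient [K] among those of smaller order. *)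
Lemma torus_orthogonality N (om : R[i]) (M K : multiindex n) :
  N.-primitive_root om -> (mi_norm M < N)%N -> (mi_norm K < N)%N ->
  \sum_(eta : {ffun 'I_n -> 'I_N})
    (\prod_(j < n) (om ^+ K j)^-1 ^+ eta j) * \prod_(j < n) (om ^+ eta j) ^+ M j =
  (N ^ n)%:R * (M == K)%:R.
Proof.
move=> omP MN KN.
pose x j := om ^+ M j / om ^+ K j.
have om0 : om != 0.
  apply/eqP => o0; have := prim_expr_order omP.
  by rewrite o0 expr0n gtn_eqF ?(prim_order_gt0 omP) // => /eqP; rewrite eq_sym oner_eq0.
transitivity (\sum_(eta : {ffun 'I_n -> 'I_N}) \prod_(j < n) x j ^+ eta j).
  apply: eq_bigr => eta _; rewrite -big_split; apply: eq_bigr => j _ /=.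
  by rewrite /x exprMn exprAC mulrC.
rewrite -(bigA_distr_bigA (fun j (e : 'I_N) => x j ^+ e)).
have [MKe|MK] := eqVneq M K.
  rewrite mulr1 natrX -[X in _ ^+ X](card_ord n) -prodr_const.
  apply: eq_bigr => j _; rewrite /x MKe divff ?expf_neq0 //.
  under eq_bigr do rewrite expr1n.
  by rewrite sumr_const card_ord.
rewrite mulr0; have [j Mj] : exists j, M j != K j.
  apply/existsP; apply: contraNT MK => /existsPn MK; apply/eqP/ffunP => j.
  by apply/eqP; rewrite -[_ == _]negbK MK.
rewrite (bigD1 j) //= [X in X * _](_ : _ = 0) ?mul0r //.
have x1 : x j - 1 != 0.
  rewrite subr_eq0 /x; apply: contraNneq Mj => xj.
  have : om ^+ M j == om ^+ K j.
    by apply/eqP; rewrite -[RHS]mul1r -xj divfK // expf_neq0.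
  rewrite (eq_prim_root_expr omP) !modn_small //.
    exact: leq_ltn_trans (mi_le_norm _ _) KN.
  exact: leq_ltn_trans (mi_le_norm _ _) MN.
apply: (mulfI x1); rewrite mulr0 -subrX1 /x exprMn exprVn -!exprM ![(_ * N)%N]mulnC.
by rewrite !exprM (prim_expr_order omP) !expr1n invr1 mulr1 subrr.
Qed.

(** The roots of unity of order [|K| + 3] tell apart the multi-indices of degree
    at most [|K| + 2]; the terms of higher degree are [O(t ^ (|K| + 3))]. *)
Lemma cauchy_estimate F z0 (r : 'rV[R]_n) (M : R) (K : multiindex n) :
  analytic_on_uball F -> (forall j, 0 <= r ord0 j) ->
  polydisc z0 r `<=` @uball R n ->
  (forall z, polydisc z0 r z -> modulus (F z) <= M) ->
  modulus (mderiv K F z0) / (mi_fact K)%:R * mi_pow r K <= M.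
Proof.
move=> FA r0 rB FM; set k := mi_norm K; pose N := k.+3.
have [om omP] := @primitive_root_exists R[i] N isT.
have om1 : modulus om = 1.
  apply/eqP; rewrite -(@pexpr_eq1 _ _ N) ?modulus_ge0 // -modulusX.
  by rewrite (prim_expr_order omP) Normc.normc1.
have z0P : polydisc z0 r z0 by move=> j; rewrite subrr Normc.normc0.
have [c [rr Fc]] := analytic_expands FA (rB _ z0P).
pose y (eta : {ffun 'I_n -> 'I_N}) : 'rV[R[i]]_n :=
  \row_j ((r ord0 j)%:C%C * om ^+ eta j).
pose ch (eta : {ffun 'I_n -> 'I_N}) := \prod_(j < n) (om ^+ K j)^-1 ^+ eta j.
have ch1 eta : modulus (ch eta) = 1.
  rewrite /ch modulus_prod big1 // => j _.
  by rewrite modulusX Normc.normcV modulusX om1 expr1n invr1 expr1n.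
pose T := index_enum {ffun 'I_n -> 'I_N}.
pose Nn : R[i] := (N ^ n)%:R.
have Nn0 : Nn != 0 by rewrite pnatr_eq0 expn_eq0.
pose G t := \sum_(eta <- T) (Nn^-1 * ch eta) * F (z0 + t *: y eta).
pose rC : 'rV[R[i]]_n := \row_j (r ord0 j)%:C%C.
have yP eta t : modulus t <= 1 -> polydisc z0 r (z0 + t *: y eta).
  move=> t1 j; rewrite !mxE addrAC subrr add0r !Normc.normcM modulusX om1 expr1n.
  by rewrite mulr1 modulus_real ger0_norm // ler_piMl.
have yE eta M' : mi_pow (y eta) M' = mi_pow rC M' * \prod_(j < n) (om ^+ eta j) ^+ M' j.
  rewrite !mi_powE -big_split; apply: eq_bigr => j _.
  by rewrite !mxE exprMn.
have PE t : \sum_(eta <- T) (Nn^-1 * ch eta) *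
    \sum_(M' <- mi_upto n k.+2) c M' * mi_pow (y eta) M' * t ^+ mi_norm M' =
    c K * mi_pow rC K * t ^+ k.
  transitivity (\sum_(M' <- mi_upto n k.+2) c M' * mi_pow rC M' * t ^+ mi_norm M' *
      (Nn^-1 * \sum_(eta <- T) ch eta * \prod_(j < n) (om ^+ eta j) ^+ M' j)).
    under eq_bigr => eta _ do rewrite mulr_sumr.
    rewrite exchange_big; apply: eq_bigr => M' _; rewrite !mulr_sumr.
    by apply: eq_bigr => eta _; rewrite yE; ring.
  have Kk : K \in mi_upto n k.+2 by rewrite mem_mi_upto /k -addn2 leq_addr.
  have KN : (mi_norm K < N)%N by rewrite /N -/k ltnS ltnW.
  rewrite (bigD1_seq K) ?mi_upto_uniq //= torus_orthogonality //.
  rewrite eqxx mulr1 mulVf // mulr1 big_seq_cond big1 ?addr0 //.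
  move=> M' /andP[]; rewrite mem_mi_upto => M'k /negbTE M'K.
  by rewrite torus_orthogonality ?M'K ?mulr0.
have [C [s [C0 s0 H]]] : approx0 k.+3 G (fun t => c K * mi_pow rC K * t ^+ k).
  under eq_fun do rewrite -PE.
  by apply: approx0_lincomb => eta; apply: approx0_line Fc.
have cK : modulus (mderiv K F z0) / (mi_fact K)%:R = modulus (c K).
  rewrite (mderiv_center K Fc) Normc.normcM modulus_nat mulrC mulKf //.
  by rewrite pnatr_eq0 -lt0n prodn_gt0 // => j; rewrite fact_gt0.
have rCE : modulus (mi_pow rC K) = mi_pow r K.
  rewrite !mi_powE modulus_prod; apply: eq_bigr => j _.
  by rewrite mxE modulusX modulus_real ger0_norm.
rewrite cK -rCE -Normc.normcM.
apply: (coef_le_of_peano2 C0 s0 H) => t t1.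
  apply: peano2_sum => eta; apply: peano2M; first exact: peano2_cst.
  by apply: peano2_line => //; apply: rB; apply: yP.
apply: le_trans (modulus_sum _ _ _) _.
apply: le_trans (_ : \sum_(eta <- T) (N ^ n)%:R^-1 * M <= _).
  apply: ler_sum => eta _.
  rewrite !Normc.normcM ch1 mulr1 Normc.normcV modulus_nat.
  by rewrite ler_wpM2l ?invr_ge0 ?ler0n // FM //; apply: yP; rewrite t1.
rewrite sumr_const card_ffun !card_ord -[_ *+ _]mulr_natl mulrA divff ?mul1r //.
by rewrite pnatr_eq0 expn_eq0.
Qed.

End Cauchy.

(** * The equivalence *)

Lemma mderiv0 (R : realType) n (F : 'rV[R[i]]_n -> R[i]) : mderiv (mi_zero n) F = F.
Proof. by rewrite /mderiv; elim: (enum _) => //= j s ->; rewrite ffunE. Qed.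

Section Equivalence.
Variables (R : realType) (n : nat) (beta : R) (L : 'rV[R[i]]_n -> 'rV[R]_n).
Variable F : 'rV[R[i]]_n -> R[i].
Hypotheses (hbeta : Num.sqrt (n%:R : R) < beta) (LQ : classQ beta L).
Hypothesis FA : analytic_on_uball F.

Definition local_growth (rad : 'rV[R]_n) : Prop :=
  exists (n0 : nat) (p0 : R), 0 < p0 /\
    forall z0 : 'rV[R[i]]_n, uball z0 ->
    exists K0 : multiindex n, (mi_norm K0 <= n0)%N /\
    exists M : R,
      is_maximum [set x | exists (K : multiindex n) (z : 'rV[R[i]]_n),
                    [/\ (mi_norm K <= n0)%N,
                        polydisc z0 (vdiv rad (L z0)) z
                      & x = normalized_deriv F L z K]] M /\
      M <= p0 * normalized_deriv F L z0 K0.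

Implicit Types (rad : 'rV[R]_n) (z : 'rV[R[i]]_n).

Let beta0 : 0 < beta. Proof. exact: le_lt_trans (sqrtr_ge0 _) hbeta. Qed.

Lemma local_growth_of_bounded_index rad : (forall j, 0 <= rad ord0 j) ->
  enorm rad <= beta -> bounded_index F L -> local_growth rad.
Proof.
move=> rad0 radb [m Fm].
have [Lam Lam1 LamP] := classQ_ratio_bound beta0 LQ rad0 radb.
have G := normalized_deriv_growth beta0 LQ FA Fm rad0 radb Lam1 LamP.
move: G; set E := Lam ^+ m * _ => G.
have E0 : 0 <= E.
  by rewrite mulr_ge0 ?sqrtr_ge0 ?exprn_ge0 // (le_trans _ Lam1).
(* The summand 1 only makes the constant positive. *)
exists m, (E * (size (mi_upto n m))%:R + 1); split.
  by rewrite ltr_wpDl // mulr_ge0.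
move=> z0 z0B.
have [|K0 K0m K0max] := @seq_argmax R _ (mi_upto n m) (normalized_deriv F L z0).
  by exists (mi_zero n); rewrite mem_mi_upto mi_norm0.
exists K0; split; first by rewrite -mem_mi_upto.
have [M MP] := normalized_deriv_max beta0 LQ m FA rad0 radb z0B.
exists M; split=> //; have [[K [z [Km zP ->]]] _] := MP.
apply: le_trans (G z0 z K z0B zP _) _; first by rewrite mem_mi_upto.
have nd0 := normalized_deriv_ge0 beta0 LQ F K0 z0B.
apply: (@le_trans _ _ (E * (size (mi_upto n m))%:R * normalized_deriv F L z0 K0)).
  rewrite -mulrA ler_wpM2l // mulr_natl -[X in _ *+ X]count_predT.
  rewrite -iter_addr_0 -big_const_seq big_seq [leRHS]big_seq.
  by apply: ler_sum => J /K0max.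
by rewrite ler_wpM2r // lerDl.
Qed.

Lemma exists_expr_ge (rho p : R) : 1 < rho -> exists s, p <= rho ^+ s.
Proof.
move=> rho1; set d := rho - 1; have d0 : 0 < d by rewrite subr_gt0.
have bern s : 1 + s%:R * d <= rho ^+ s.
  elim: s => [|s IH]; first by rewrite mul0r addr0.
  rewrite exprS; apply: (@le_trans _ _ (rho * (1 + s%:R * d))).
    have : 0 <= s%:R * d * d by rewrite !mulr_ge0 ?ler0n // ltW.
    have -> : rho = 1 + d by rewrite /d; ring.
    by rewrite -natr1; lra.
  by rewrite ler_wpM2l // ltW // (lt_trans _ rho1).
exists (Num.Def.archi_bound (`|p| / d)); apply: le_trans (bern _).
apply: le_trans (ler_norm p) _; rewrite -[leLHS]add0r lerD //.
by rewrite -ler_pdivrMr // ltW // archi_boundP // divr_ge0 // ltW.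
Qed.

(** The reason for requiring [beta > sqrt n]: Cauchy's inequality gives decay for
    radii above 1, and [n] of them fit in a vector of norm [beta]. *)
Lemma exists_equal_radii : exists2 rho : R, 1 < rho & Num.sqrt n%:R * rho <= beta.
Proof.
have [n0|n0] := eqVneq (Num.sqrt n%:R : R) 0.
  by exists 2; rewrite ?ltr1n // n0 mul0r ltW.
have s0 : 0 < Num.sqrt n%:R :> R by rewrite lt_def n0 sqrtr_ge0.
exists (beta / Num.sqrt n%:R); first by rewrite ltr_pdivlMr // mul1r.
by rewrite mulrC divfK.
Qed.

(** Cauchy's inequality for [F] itself makes the normalized derivative [J] decay
    like [rho ^ - |J|], which eventually absorbs the constant [p0]. *)
Lemma bounded_index_of_local_growth rho : 1 < rho -> local_growth (const_mx rho) ->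
  Num.sqrt n%:R * rho <= beta -> bounded_index F L.
Proof.
move=> rho1 [n0 [p0 [p00 H]]] rhob.
have rho0 : 0 < rho by apply: lt_trans rho1.
have [s sP] := exists_expr_ge p0 rho1.
(* The index has to exceed both the order of [K0] and the degree from which the
   decay takes over. *)
exists (maxn n0 s) => z0 J z0B; set m := maxn n0 s.
have head K : (mi_norm K <= m)%N -> normalized_deriv F L z0 K <=
    \big[Num.max/0]_(K : {ffun 'I_n -> 'I_m.+1} | (mi_norm (mi_of K) <= m)%N)
      normalized_deriv F L z0 (mi_of K).
  rewrite -mem_mi_upto => /mapP[K']; rewrite mem_filter => /andP[K'm _] ->.
  exact: (le_bigmax_cond _ (fun K => normalized_deriv F L z0 (mi_of K))).
have [/head//|mJ] := leqP (mi_norm J) m.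
have [K0 [K0n [M [[_ MU] Mle]]]] := H z0 z0B.
apply: le_trans (_ : normalized_deriv F L z0 K0 <= _); last first.
  by apply: head; rewrite (leq_trans K0n) // leq_maxl.
have r0 j : 0 <= (const_mx rho : 'rV[R]_n) ord0 j by rewrite mxE ltW.
have rb : enorm (const_mx rho : 'rV[R]_n) <= beta by rewrite enorm_const // ltW.
have FM z : polydisc z0 (vdiv (const_mx rho) (L z0)) z -> modulus (F z) <= M.
  move=> zP; apply: MU; exists (mi_zero n), z; split => //; first by rewrite mi_norm0.
  rewrite /normalized_deriv mi_pow0 mulr1 mderiv0 /mi_fact big1 ?divr1 // => j _.
  by rewrite ffunE.
have := cauchy_estimate J FA (fun j => vdiv_ge0 beta0 LQ j r0 z0B)
  (polydisc_sub_uball beta0 LQ r0 rb z0B) FM.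
have LJ := mi_pow_L_gt0 beta0 LQ J z0B.
have -> : mi_pow (vdiv (const_mx rho) (L z0)) J = rho ^+ mi_norm J / mi_pow (L z0) J.
  rewrite /mi_norm expr_sum !mi_powE -prodfV -big_split; apply: eq_bigr => j _.
  by rewrite !mxE expr_div_n.
have -> : modulus (mderiv J F z0) / (mi_fact J)%:R * (rho ^+ mi_norm J / mi_pow (L z0) J) =
    rho ^+ mi_norm J * normalized_deriv F L z0 J.
  rewrite /normalized_deriv invfM; ring.
move=> le_M; have nd0 := normalized_deriv_ge0 beta0 LQ F K0 z0B.
have pJ : p0 <= rho ^+ mi_norm J.
  apply: le_trans sP _; rewrite ler_weXn2l ?ltW // ltnW //.
  by rewrite (leq_ltn_trans _ mJ) // leq_maxr.
have rJ : 0 < rho ^+ mi_norm J by rewrite exprn_gt0.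
rewrite -(ler_pM2l rJ); apply: le_trans le_M _; apply: le_trans Mle _.
by rewrite ler_wpM2r.
Qed.

End Equivalence.

Unset Implicit Arguments.

Theorem theorem1 (R : realType) (n : nat) (beta : R)
    (L : 'rV[R[i]]_n -> 'rV[R]_n) (F : 'rV[R[i]]_n -> R[i])
    (hbeta : Num.sqrt (n%:R : R) < beta)
    (hL : classQ beta L) (hF : analytic_on_uball F) :
  bounded_index F L <->
  (forall rad : 'rV[R]_n, (forall j : 'I_n, 0 <= rad ord0 j) ->
     enorm rad <= beta ->
     exists (n0 : nat) (p0 : R), 0 < p0 /\
       forall z0 : 'rV[R[i]]_n, uball z0 ->
       exists K0 : multiindex n, (mi_norm K0 <= n0)%N /\
       exists M : R,
         is_maximum [set x | exists (K : multiindex n) (z : 'rV[R[i]]_n),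
                       [/\ (mi_norm K <= n0)%N,
                           polydisc z0 (vdiv rad (L z0)) z
                         & x = normalized_deriv F L z K]] M /\
         M <= p0 * normalized_deriv F L z0 K0).
Proof.
split=> [Fb rad rad0 radb|H].
  exact: local_growth_of_bounded_index radb Fb.
have [rho rho1 rhob] := exists_equal_radii hbeta.
have rho0 : 0 <= rho by rewrite ltW // (lt_trans _ rho1).
apply: (bounded_index_of_local_growth hbeta hL hF rho1 _ rhob).
apply: H => [j|]; first by rewrite mxE.
by rewrite enorm_const.
Qed.
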